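(* Let $H\in(0,1)$, let $W(n)\sim N(0,1)$, $n\ge0$, be standard Gaussian white noise, let $$W^H(n)=\sum_{i=0}^{n}h_{n-i}^{H-\frac12}\,W(i)\quad\text{if }H\neq\tfrac12,\qquad W^H(n)=W(n)\quad\text{if }H=\tfrac12,$$ where $h_{n}^{H-\frac12}=\dfrac{\Gamma(n+H-\frac12)}{\Gamma(H-\frac12)\,\Gamma(n+1)}$, and let $B^H(n)=\sum_{i=0}^{n}W^H(i)$ be the standard discrete-time fractional Brownian motion (fBm) with Hurst exponent $H$. Suppose that the sequence $B^H(n)$ is bounded within $[-b,b]$ in a finite time horizon $[0,t]$, that an $M$-level uniform quantizer in $[-b,b]$ is applied to it, and put $\Delta=\frac{2b}{M-1}$. Then, under the assumption of high resolution (the sample rate and the resolution of the quantizer are high enough), the normalized quantization noise $e(n)$ of $B^H$ with this uniform quantizer is asymptotically uniformly distributed and white. That is: (1) the distribution of $e(n)$ converges to the uniform distribution on $[-\frac12,\frac12]$ as $n\to\infty$; (2) the limit correlation of $e$ satisfies $$\bar{\mathrm R}\big(e(n),e(n+k)\big)=\begin{cases}\frac1{12}, & k=0,\\ 0, & k\neq 0.\end{cases}$$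
   Context: $\Gamma$ is the Gamma function, and $\langle x\rangle=x \bmod 1$ is the fractional part of a real number $x$. In the setting above (signal $S(n)$ bounded within $[-b,b]$ in a finite time horizon, $M$-level uniform quantizer in $[-b,b]$, $\Delta=\frac{2b}{M-1}$, sample rate and quantizer resolution assumed high enough), the normalized quantization noise $e(n)$ of $S$ is represented as the normalized quantization noise of the sigma-delta modulator for $S$: $$e(n)=\frac12-\Big\langle\sum_{i=0}^{n}\Big(\frac{S(i)}{\Delta}+\frac12\Big)\Big\rangle .$$ Here $S=B^H$. ''High resolution'' is used informally, in the sense just described; no quantitative condition on $M$, $b$ or $\Delta$ is specified. The limit mean is $\bar{\mathrm E}(x(n))=\lim_{N\to\infty}\frac1N\sum_{n=1}^{N}\mathrm E(x(n))$, and the limit correlation is $\bar{\mathrm R}(e(n),e(n+k))=\bar{\mathrm E}\big(e(n)e(n+k)\big)$. *)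

(* Defs.v *)
From HB Require Import structures.
From mathcomp Require Import all_boot all_order all_algebra.
From mathcomp Require Import all_classical all_reals all_analysis.
From mathcomp Require Import measurable_realfun.

Set Implicit Arguments.
Unset Strict Implicit.
Unset Printing Implicit Defensive.

Import Order.TTheory GRing.Theory Num.Theory.
Import numFieldNormedType.Exports.

Local Open Scope classical_set_scope.
Local Open Scope ring_scope.

Section gamma.
Context {R : realType}.

Definition gamma_integral (x : R) : R :=
  \int[lebesgue_measure]_(s in `]0, +oo[) (s `^ (x - 1) * expR (- s)).

Definition gamma_shift (x : R) : nat :=
  if 0 < x then 0%N else (Num.truncn (- x)).+1.

(* Euler's integral for 0 < x; for x <= 0, the extension by
   Gamma(x) = Gamma(x + k) / (x (x + 1) ... (x + k - 1)), where k is the least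
   natural number such that 0 < x + k. The value at the poles 0, -1, -2, ... is
   the junk value 0. *)
Definition Gamma (x : R) : R :=
  gamma_integral (x + (gamma_shift x)%:R) /
  \prod_(0 <= i < gamma_shift x) (x + i%:R).

(* The coefficients h_n^a of (1 - z)^(- a), for a <> 0, -1, -2, ... *)
Definition hcoef (a : R) (n : nat) : R :=
  Gamma (n%:R + a) / (Gamma a * Gamma (n%:R + 1)).

Definition frac (x : R) : R := x - (Num.floor x)%:~R.

Lemma measurable_frac : measurable_fun setT frac.
Proof.
apply: measurable_funB => //; apply: nondecreasing_measurable => // x y xy.
by rewrite ler_int le_floor.
Qed.

End gamma.

Section processes.
Context {d : measure_display} {T : measurableType d} {R : realType}.
Implicit Types (W S : nat -> {mfun T >-> R}).

Definition fgn_fun (H : R) W (n : nat) (w : T) : R :=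
  if H == 2^-1 then W n w
  else \sum_(0 <= i < n.+1) hcoef (H - 2^-1) (n - i) * W i w.

Lemma measurable_fgn_fun H W n : measurable_fun setT (fgn_fun H W n).
Proof.
rewrite /fgn_fun; case: eqP => _ //.
by apply: measurable_sum => i; apply: measurable_funM.
Qed.

HB.instance Definition _ H W n :=
  isMeasurableFun.Build _ _ _ _ (fgn_fun H W n) (@measurable_fgn_fun H W n).

Definition fgn (H : R) W (n : nat) : {mfun T >-> R} := fgn_fun H W n.

Definition fbm_fun (H : R) W (n : nat) (w : T) : R :=
  \sum_(0 <= i < n.+1) fgn H W i w.

Lemma measurable_fbm_fun H W n : measurable_fun setT (fbm_fun H W n).
Proof. exact: measurable_sum. Qed.

HB.instance Definition _ H W n :=
  isMeasurableFun.Build _ _ _ _ (fbm_fun H W n) (@measurable_fbm_fun H W n).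

Definition fbm (H : R) W (n : nat) : {mfun T >-> R} := fbm_fun H W n.

(* Step of the M-level uniform quantizer in [-b, b]. *)
Definition quantizer_step (b : R) (M : nat) : R := 2 * b / (M%:R - 1).

Definition quantization_noise_fun (b : R) (M : nat) S (n : nat) (w : T) : R :=
  2^-1 - frac (\sum_(0 <= i < n.+1) (S i w / quantizer_step b M + 2^-1)).

Lemma measurable_quantization_noise_fun b M S n :
  measurable_fun setT (quantization_noise_fun b M S n).
Proof.
apply: measurable_funB => //; apply: (measurableT_comp measurable_frac).
apply: measurable_sum => i; apply: measurable_funD => //.
exact: measurable_funM.
Qed.

HB.instance Definition _ b M S n :=
  isMeasurableFun.Build _ _ _ _ (quantization_noise_fun b M S n)
    (@measurable_quantization_noise_fun b M S n).

(* Under high resolution, the normalized quantization noise of the signal S is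
   that of the sigma-delta modulator driven by S. *)
Definition quantization_noise (b : R) (M : nat) S (n : nat) :
  {mfun T >-> R} := quantization_noise_fun b M S n.

Definition bounded_on_horizon S (b : R) (t : nat) : set T :=
  [set w | forall n, (n <= t)%N -> S n w \in `[- b, b]].

Lemma measurable_bounded_on_horizon S b t :
  measurable (bounded_on_horizon S b t).
Proof.
rewrite (_ : bounded_on_horizon S b t =
    \bigcap_n (if (n <= t)%N then S n @^-1` `[- b, b] else setT)).
  apply: bigcap_measurable => // n _; case: ifP => // _.
  by rewrite -[X in measurable X]setTI; exact: measurable_funPT.
apply/seteqP; split => w /= Sw n => [_|nt]; first by case: ifP => // /Sw.
by have := Sw n I; rewrite nt.
Qed.

End processes.

Section laws.
Local Open Scope ereal_scope.
Context {d : measure_display} {T : measurableType d} {R : realType}.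
Implicit Types P : probability T R.

Definition mutually_independent P (X : nat -> {mfun T >-> R}) : Prop :=
  forall (J : seq nat) (A : nat -> set (measurableTypeR R)), uniq J ->
    (forall j, measurable (A j)) ->
    P [set w | forall j, j \in J -> A j (X j w)] =
    \prod_(j <- J) P (X j @^-1` A j).

Definition standard_gaussian_white_noise P (W : nat -> {mfun T >-> R}) : Prop :=
  (forall n (A : set (measurableTypeR R)), measurable A ->
     distribution P (W n) A = normal_prob 0%R 1%R A) /\
  mutually_independent P W.

(* The conditional probability P( . | A); the library's mnormalize makes it P
   itself when P A = 0. *)
Definition cond_probability P (A : set T) (mA : measurable A) :
  probability T R := mnormalize (mrestr P mA) P.

Definition converges_in_distribution P (X : nat -> {mfun T >-> R})
    (Y : probability (measurableTypeR R) R) : Prop :=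
  forall x : R, {for x, continuous (fun y : R => Y `]-oo, y]%classic)} ->
    cdf (X n : {RV P >-> R}) x @[n --> \oo] --> Y `]-oo, x]%classic.

Definition has_limit_mean P (x : nat -> T -> R) (l : \bar R) : Prop :=
  (N%:R^-1)%:E * (\sum_(1 <= n < N.+1) 'E_P[x n]) @[N --> \oo] --> l.

(* Two-sided extension of a process indexed by the natural numbers. *)
Definition extend_by0 (x : nat -> T -> R) (z : int) : T -> R :=
  if z is Posz n then x n else cst 0%R.

(* The lag k is any integer: for k < 0 the finitely many n such that n + k < 0
   contribute 0, hence do not affect the limit. *)
Definition has_limit_correlation P (x : nat -> T -> R) (k : int) (l : \bar R) :
    Prop :=
  has_limit_mean P (fun n w => x n w * extend_by0 x (n%:Z + k)%R w)%R l.

Lemma ltNhalf_half : (- 2^-1 < 2^-1 :> R)%R.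
Proof. by rewrite (@lt_trans _ _ 0%R) ?oppr_lt0 ?invr_gt0. Qed.

Definition asymptotically_uniform P (e : nat -> {mfun T >-> R}) : Prop :=
  converges_in_distribution P e (uniform_prob ltNhalf_half).

Definition asymptotically_white P (e : nat -> {mfun T >-> R}) : Prop :=
  forall k : int,
    has_limit_correlation P (fun n => e n : T -> R) k
      (if (k == 0 :> int)%R then 12^-1%:E else 0).

End laws.

(* Main.v *)
(* The sigma-delta state X n, the sum of the S i / Delta + 1/2 for i <= n, is
   (n + 1) / 2 + sum_(j <= n) (c (n - j) / Delta) W j, where the c m are the
   coefficients of (1 - z)^(- (a + 2)) with a = H - 1/2. They tend to infinity,
   the gaps c (l + k) - c l are negligible with respect to c l, and the sum over
   l of their squares diverges because a > - 1/2.

   A Gaussian variable of large standard deviation s, reduced modulo 1, is almost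
   uniform: the mean of a nonnegative 1-periodic f under N(x, s^2) is at most
   (1 + 2 / (s sqrt (2 pi))) times the integral of f over a period, by
   unimodality of the density. For F (x, e) nonnegative and 1-periodic in both
   variables, put D = X (n + k) - X n. A rotation of the plane of the two noises
   W (t + 1) and W (n + k) isolates a Gaussian direction of large variance that
   moves X n but not D, which averages F over x; then the noises
   W (t + 1), ..., W n together give D a large variance, which averages over e.
   Hence E F (X n, D) is at most (1 + o(1)) times the mean of F over the unit
   square. For 0 <= F <= 1 the same bound for 1 - F turns this into a limit, and
   (X n, X (n + k)) modulo 1 becomes uniform on the torus.

   Only the noises with index > t are averaged, so the argument applies verbatim
   to P conditioned on an event that depends on W 0, ..., W t. *)

Require Import Defs.
From HB Require Import structures.
From mathcomp Require Import all_boot all_order all_algebra.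
From mathcomp Require Import all_classical all_reals all_analysis.
From mathcomp Require Import measurable_realfun.
From mathcomp Require Import ring lra zify.
Import Order.TTheory GRing.Theory Num.Theory.
Import numFieldNormedType.Exports.
Local Open Scope classical_set_scope.
Local Open Scope ring_scope.

Set Implicit Arguments.
Unset Strict Implicit.
Unset Printing Implicit Defensive.

(* The library declares [pushforward m f] as a measure, but the measurability of
   [f] is an argument of that instance which unification cannot find. *)
Definition image_measure d1 d2 (T1 : measurableType d1) (T2 : measurableType d2)
    (R : realType) (m : {measure set T1 -> \bar R}) (f : T1 -> T2)
    (mf : measurable_fun setT f) : {measure set T2 -> \bar R} :=
  measure_function_pushforward__canonical__measure_function_Measure m mf.

(** * Lebesgue and Gaussian integrals *)

Section affine.
Context {R : realType}.
Local Open Scope ereal_scope.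
Notation mu := (@lebesgue_measure R).

(** Multiplied by [|a|], the left side is a measure in [A]. By uniqueness of Lebesgue measure it
    suffices to treat intervals []x, y]], whose preimages are again intervals; a negative slope
    swaps the open and the closed end. *)
Lemma lebesgue_measure_affine (a b : R) (A : set (measurableTypeR R)) :
  a != 0%R -> measurable A ->
  mu ((fun x => a * x + b)%R @^-1` A) = (`|a|^-1)%:E * mu A.
Proof.
move=> a0 mA.
pose phi := (fun x => a * x + b)%R : measurableTypeR R -> measurableTypeR R.
have mphi : measurable_fun setT phi.
  by apply: measurable_funD => //; exact: measurable_funM.
have na0 : (0 < `|a|)%R by rewrite normr_gt0.
pose nu := mscale (NngNum (ltW na0)) (image_measure mu mphi).
suff -> : mu A = nu A.
  by rewrite /nu /mscale/= muleA -EFinM mulVf ?mul1e// gt_eqF.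
apply: lebesgue_measure_unique => //= _ [[x y]] /= _ <-.
transitivity (`|a|%:E * mu (phi @^-1` `]x, y]%classic)); last by [].
have [agt0|ale0] := ltP 0%R a.
  rewrite (_ : _ @^-1` _ = `](x - b) / a, (y - b) / a]%classic)%R; last first.
    apply/seteqP; split => z /=; rewrite /phi !in_itv/= ltr_pdivrMr// ler_pdivlMr//;
      by rewrite ltrBlDr lerBrDr [(z * a)%R]mulrC.
  rewrite !lebesgue_measure_itv/= !lte_fin ltr_pM2r ?invr_gt0// ltrD2r.
  case: ifPn => xy; last by rewrite mule0.
  by rewrite -!EFinB -EFinM gtr0_norm//; congr EFin; field.
have alt0 : (a < 0)%R by rewrite lt_neqAle a0.
rewrite (_ : _ @^-1` _ = `[(y - b) / a, (x - b) / a[%classic)%R; last first.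
  apply/seteqP; split => z /=; rewrite /phi !in_itv/= ltr_ndivlMr// ler_ndivrMr//;
    by rewrite ltrBlDr lerBrDr [(z * a)%R]mulrC andbC.
rewrite !lebesgue_measure_itv/= !lte_fin ltr_nM2r ?invr_lt0// ltrD2r.
case: ifPn => xy; last by rewrite mule0.
by rewrite -!EFinB -EFinM ltr0_norm//; congr EFin; field.
Qed.

Lemma ge0_integral_affine (a b : R) (f : R -> \bar R) :
  a != 0%R -> measurable_fun setT f -> (forall x, 0 <= f x) ->
  \int[mu]_x f (a * x + b)%R = (`|a|^-1)%:E * \int[mu]_x f x.
Proof.
move=> a0 mf f0.
pose phi := (fun x => a * x + b)%R : measurableTypeR R -> measurableTypeR R.
have mphi : measurable_fun setT phi.
  by apply: measurable_funD => //; exact: measurable_funM.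
have na0 : (0 <= `|a|^-1)%R by rewrite invr_ge0.
transitivity (\int[image_measure mu mphi]_x f x).
  by rewrite ge0_integral_pushforward//= ?preimage_setT.
rewrite (_ : \int[image_measure mu mphi]_x f x = \int[mscale (NngNum na0) mu]_x f x).
  by rewrite ge0_integral_mscale.
apply: eq_measure_integral => A mA _.
exact: lebesgue_measure_affine.
Qed.

Import HBNNSimple.

(** Linearity extends the density formula from sets to the simple functions [f_ n], and monotone
    convergence on both sides extends it to [f]. *)
Lemma ge0_integral_density (nu : {measure set (measurableTypeR R) -> \bar R})
    (g : R -> R) (f : R -> \bar R) :
  measurable_fun setT g -> (forall x, 0 <= g x)%R ->
  (forall A, measurable A -> nu A = \int[mu]_(x in A) (g x)%:E) ->
  measurable_fun setT f -> (forall x, 0 <= f x) ->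
  \int[nu]_x f x = \int[mu]_x (f x * (g x)%:E).
Proof.
move=> mg g0 nuE mf f0.
have mg' : measurable_fun setT (EFin \o g) by exact/measurable_EFinP.
pose f_ := nnsfun_approx measurableT mf.
have step n : \int[nu]_x (f_ n x)%:E = \int[mu]_x ((f_ n x)%:E * (g x)%:E).
  have mpre r : measurable (f_ n @^-1` [set r]) by exact: measurable_funPTI.
  have mind r : measurable_fun setT (fun x => (r * \1_(f_ n @^-1` [set r]) x)%:E).
    by apply/measurable_EFinP; apply: measurable_funM => //; exact: measurable_indic.
  under [LHS]eq_integral do rewrite fimfunE -fsumEFin//.
  rewrite [LHS]ge0_integral_fsum//; last first.
    by move=> r x _; rewrite EFinM nnfun_muleindic_ge0.
  under [RHS]eq_integral.
    move=> x _; rewrite fimfunE -fsumEFin// ge0_mule_fsuml; last first.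
      by move=> r; rewrite EFinM nnfun_muleindic_ge0.
    over.
  rewrite [RHS]ge0_integral_fsum//; last 2 first.
    - by move=> r; apply: emeasurable_funM => //; exact: mind.
    - move=> r x _; apply: mule_ge0; last by rewrite lee_fin.
      by rewrite EFinM nnfun_muleindic_ge0.
  apply: eq_fsbigr => r _.
  (* A negative value is never taken by the nonnegative [f_ n], so both terms are integrals of 0. *)
  have [r0|r0] := leP 0%R r; last first.
    rewrite preimage_nnfun0//= !integral0_eq// => x _;
      by rewrite indicE in_set0 mulr0 ?mul0e.
  have mi : measurable_fun setT (fun x => (\1_(f_ n @^-1` [set r]) x)%:E : \bar R).
    by apply/measurable_EFinP; exact: measurable_indic.
  under [LHS]eq_integral do rewrite EFinM.
  under [RHS]eq_integral do rewrite EFinM -muleA.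
  rewrite !ge0_integralZl//; last 2 first.
    - exact: emeasurable_funM.
    - by move=> x _; rewrite mule_ge0 ?lee_fin.
  congr (_ * _); transitivity (nu (f_ n @^-1` [set r])).
    have -> : nu (f_ n @^-1` [set r]) = nu (f_ n @^-1` [set r] `&` setT).
      by congr (nu _); apply/esym; exact: setIT.
    by apply: integral_indic; [exact: measurableT|exact: (mpre r)].
  rewrite (nuE _ (mpre r)) [LHS]integral_mkcond.
  apply: eq_integral => x _; rewrite patchE indicE.
  by case: ifPn => _ /=; rewrite ?mul1e// mul0e.
have mfn n : measurable_fun setT (fun x => (f_ n x)%:E : \bar R).
  by apply/measurable_EFinP.
have fnd m n x : (m <= n)%N -> (f_ m x <= f_ n x)%R.
  by move=> /(nd_nnsfun_approx measurableT mf)/lefP; exact.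
transitivity (limn (fun n => \int[nu]_x (f_ n x)%:E)).
  rewrite -monotone_convergence//=.
  - apply: eq_integral => ? /[!inE] xD; apply/esym/cvg_lim => //=.
    exact: cvg_nnsfun_approx.
  - by move=> n ? _; rewrite lee_fin.
  - by move=> ? _ ? ? mn; rewrite lee_fin; exact: fnd.
under eq_fun do rewrite step.
rewrite -monotone_convergence//=.
- apply: eq_integral => x _; apply/cvg_lim => //=.
  by apply: cvgeZr => //; exact: cvg_nnsfun_approx.
- by move=> n; apply: emeasurable_funM; [exact: mfn|exact: mg'].
- by move=> n ? _; rewrite mule_ge0 ?lee_fin.
- move=> ? _ ? ? mn; rewrite lee_wpmul2r ?lee_fin//.
  exact: fnd.
Qed.

End affine.

Lemma integral_probability_cst d (T : measurableType d) (R : realType)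
    (P : probability T R) (k : \bar R) : (\int[P]__ k = k)%E.
Proof.
transitivity (k * P setT)%E; first exact: integral_cst.
have -> : P setT = 1%E by exact: probability_setT.
by rewrite mule1.
Qed.

(** * Integrals of 1-periodic functions *)

Section periodic.
Context {R : realType}.
Local Open Scope ereal_scope.
Notation mu := (@lebesgue_measure R).
Notation RR := (measurableTypeR R).

Definition periodic1 (f : R -> \bar R) := forall x, f (x + 1)%R = f x.

Lemma periodic1_int (f : R -> \bar R) (x : R) (z : int) :
  periodic1 f -> f (x + z%:~R)%R = f x.
Proof.
move=> pf.
have pfn (n : nat) y : f (y + n%:R)%R = f y.
  elim: n y => [y|n IH y]; first by rewrite addr0.
  by rewrite -natr1 addrA pf IH.
case: z => n; first exact: pfn.
by rewrite NegzE mulrNz -[in RHS](subrK (n.+1%:R) x) pfn.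
Qed.

Lemma measurable_translate (b : R) : measurable_fun (setT : set RR)
  ((fun x => x + b)%R : RR -> RR).
Proof. exact: measurable_funD. Qed.

Lemma ge0_integral_translate (c : R) (f : RR -> \bar R) :
  measurable_fun setT f -> (forall x, 0 <= f x) ->
  \int[mu]_x f (x + c)%R = \int[mu]_x f x.
Proof.
move=> mf f0; rewrite -[RHS]mul1e.
have := @ge0_integral_affine R 1 c f (oner_neq0 _) mf f0.
rewrite normr1 invr1 => <-.
by apply: eq_integral => x _; rewrite mul1r.
Qed.

Lemma ge0_integral_itv_translate (b1 b2 : bool) (a b c : R) (f : RR -> \bar R) :
  measurable_fun setT f -> (forall x, 0 <= f x) ->
  \int[mu]_(x in [set` Interval (BSide b1 a) (BSide b2 b)]) f (x + c)%R =
  \int[mu]_(x in [set` Interval (BSide b1 (a + c)%R) (BSide b2 (b + c)%R)]) f x.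
Proof.
move=> mf f0; rewrite integral_mkcond [RHS]integral_mkcond.
rewrite -[RHS](ge0_integral_translate c); last 2 first.
- apply/(measurable_restrictT _ _).1; first exact: measurable_itv.
  exact: measurable_funTS.
- by move=> x; apply: erestrict_ge0 => y _; exact: f0.
apply: eq_integral => x _; rewrite !patchE.
suff -> : (x \in [set` Interval (BSide b1 a) (BSide b2 b)]) =
  ((x + c)%R \in [set` Interval (BSide b1 (a + c)%R) (BSide b2 (b + c)%R)]) by [].
apply/idP/idP; rewrite !inE; case: b1; case: b2; rewrite /= !in_itv/=;
  by rewrite ?lerD2r ?ltrD2r.
Qed.

Lemma integral_itv_cc_co (a b : R) (f : RR -> \bar R) :
  measurable_fun setT f ->
  \int[mu]_(x in `[a, b]) f x = \int[mu]_(x in `[a, b[) f x.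
Proof.
by move=> mf; apply/esym/integral_itv_bndo_bndc; exact: measurable_funTS.
Qed.

(** Translating by the floor of [u] replaces [u] by its fractional part [r]. Then the piece over
    [[1, r + 1[] is the translate by 1 of the piece over [[0, r[]; half-open intervals make the
    pieces disjoint. *)
Lemma integral_periodic1 (u : R) (f : RR -> \bar R) :
  measurable_fun setT f -> (forall x, 0 <= f x) -> periodic1 f ->
  \int[mu]_(x in `[u, (u + 1)%R]) f x = \int[mu]_(x in `[0%R, 1%R]) f x.
Proof.
move=> mf f0 pf; rewrite !integral_itv_cc_co//.
set k := Num.floor u; set r := (u - k%:~R)%R.
have r0 : (0 <= r)%R by rewrite subr_ge0 floor_le.
have r1 : (r <= 1)%R.
  by rewrite lerBlDl addrC -[1%R]/(1%:~R) addrC -intrD ltW// floorD1_gt.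
have split (a b c : R) : (a <= b)%R -> (b <= c)%R ->
    \int[mu]_(x in `[a, c[) f x =
    \int[mu]_(x in `[a, b[) f x + \int[mu]_(x in `[b, c[) f x.
  move=> ab bc; rewrite -ge0_integral_setU//=.
  - by rewrite -itv_bndbnd_setU// bnd_simp.
  - by move=> *; apply: measurable_funTS.
  - apply/disj_setPS => x []/=; rewrite !in_itv/= => /andP[_ xb] /andP[bx _].
    by move: (lt_le_trans xb bx); rewrite ltxx.
have -> : \int[mu]_(x in `[u, (u + 1)%R[) f x = \int[mu]_(x in `[r, (r + 1)%R[) f x.
  transitivity (\int[mu]_(x in `[r, (r + 1)%R[) f (x + k%:~R)%R).
    rewrite ge0_integral_itv_translate// /r subrK.
    by rewrite [(_ - _ + 1)%R]addrAC subrK.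
  by apply: eq_integral => x _; rewrite periodic1_int.
rewrite (split r 1%R (r + 1)%R)// ?lerDr//.
rewrite (split 0%R r 1%R)// addeC; congr (_ + _).
rewrite -{1}[1%R]add0r -ge0_integral_itv_translate//.
by apply: eq_integral => x _; rewrite pf.
Qed.

(* The integral of f * G is compared with the integrals of f against the
   translates of G by v, which are averaged over v in [a, a + 1]. *)
Lemma periodic1_integral_le (f : RR -> \bar R) (G : RR -> R) (a j c : R) :
  measurable_fun setT f -> (forall x, 0 <= f x) -> periodic1 f ->
  measurable_fun setT G -> (forall x, 0 <= G x)%R -> (0 <= c)%R ->
  (forall u v, a <= v <= a + 1 ->
     G u <= G (u - v) + c * \1_`[j, j + 1] u)%R ->
  \int[mu]_x (f x * (G x)%:E) <=
  (\int[mu]_x (G x)%:E + c%:E) * \int[mu]_(x in `[0%R, 1%R]) f x.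
Proof.
move=> mf f0 pf mG G0 c0 Gle.
set I := \int[mu]_(x in `[0%R, 1%R]) f x.
have I0 : 0 <= I by exact: integral_ge0.
have mGE : measurable_fun (setT : set RR) (fun x => (G x)%:E : \bar R).
  exact/measurable_EFinP.
have aa1 : (a < a + 1)%R by rewrite ltrDl.
pose U := uniform_prob aa1.
pose h (p : RR * RR) : \bar R := f (p.2 + p.1)%R * (G p.2)%:E.
have mh : measurable_fun setT h.
  apply: emeasurable_funM; last exact: (measurableT_comp mGE).
  apply: (measurableT_comp mf).
  exact: (measurable_funD measurable_snd measurable_fst).
have h0 p : 0 <= h p by rewrite mule_ge0 ?lee_fin.
have mind : measurable_fun (setT : set RR)
    (fun x => (\1_`[j, (j + 1)%R] x)%:E : \bar R).
  by apply/measurable_EFinP; apply: measurable_indic; exact: measurable_itv.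
have step v : (a <= v <= a + 1)%R ->
    \int[mu]_x (f x * (G x)%:E) <= \int[mu]_x h (v, x) + c%:E * I.
  move=> av.
  have -> : \int[mu]_x h (v, x) = \int[mu]_x (f x * (G (x - v))%:E).
    rewrite -[RHS](ge0_integral_translate v).
    + by apply: eq_integral => x _; rewrite /h/= addrK.
    + apply: emeasurable_funM => //.
      apply: (measurableT_comp mGE); exact: measurable_translate.
    + by move=> x; rewrite mule_ge0 ?lee_fin.
  (* Every window of length 1 carries the same integral of [f], so the error supported on
     [[j, j + 1]] costs exactly [c * I]. *)
  have -> : c%:E * I = \int[mu]_x (f x * (c * \1_`[j, (j + 1)%R] x)%:E).
    rewrite /I -(integral_periodic1 j)// integral_mkcond -ge0_integralZl//.
    + apply: eq_integral => x _; rewrite epatch_indic/= EFinM.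
      by rewrite muleCA.
    + apply/(measurable_restrictT _ _).1; first exact: measurable_itv.
      exact: measurable_funTS.
    + by move=> x _; apply: erestrict_ge0 => y _; exact: f0.
  rewrite -ge0_integralD//; last 4 first.
  - by move=> x _; rewrite mule_ge0 ?lee_fin.
  - apply: emeasurable_funM => //.
    apply: (measurableT_comp mGE); exact: measurable_translate.
  - by move=> x _; rewrite mule_ge0 ?lee_fin// mulr_ge0.
  - apply: emeasurable_funM => //.
    under eq_fun do rewrite EFinM.
    by apply: emeasurable_funM => //; exact: measurable_cst.
  apply: ge0_le_integral => //.
  - by move=> x _; rewrite mule_ge0 ?lee_fin.
  - exact: emeasurable_funM.
  - apply: emeasurable_funD.
      apply: emeasurable_funM => //.
      apply: (measurableT_comp mGE); exact: measurable_translate.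
    apply: emeasurable_funM => //.
    under eq_fun do rewrite EFinM.
    by apply: emeasurable_funM => //; exact: measurable_cst.
  - move=> x _; rewrite -ge0_muleDr ?lee_fin ?mulr_ge0//.
    by rewrite lee_wpmul2l// -EFinD lee_fin; exact: Gle.
have mPhi : measurable_fun (setT : set RR) (fun v => \int[mu]_x h (v, x)).
  exact: (measurable_fun_fubini_tonelli_F h mh h0).
have Phi0 v : 0 <= \int[mu]_x h (v, x) by exact: integral_ge0.
(* With [v] uniform on [[a, a + 1]], Tonelli lets [f (x + v)] be averaged over [v] first. This gives
   [I] for every [x] and leaves the total mass of [G]. *)
have -> : (\int[mu]_x (G x)%:E + c%:E) * I =
    \int[U]_v (\int[mu]_x h (v, x) + c%:E * I).
  rewrite ge0_integralD//; last by move=> x _; rewrite mule_ge0 ?lee_fin.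
  rewrite [X in _ = _ + X]integral_probability_cst.
  rewrite (fubini_tonelli h mh h0)/=.
  rewrite ge0_muleDl ?lee_fin//; last first.
    by apply: integral_ge0 => x _; rewrite lee_fin.
  congr (_ + _); rewrite muleC -ge0_integralZl//; last first.
    by move=> x _; rewrite lee_fin.
  apply: eq_integral => x _; rewrite /h/=.
  rewrite ge0_integralZr//.
  - congr (_ * _); rewrite integral_uniform//.
    + rewrite [(a + 1)%R]addrC addrK invr1 mul1e.
      under eq_integral do rewrite addrC.
      rewrite ge0_integral_itv_translate//.
      have -> : (1 + a + x = a + x + 1)%R by ring.
      by rewrite /I -(integral_periodic1 (a + x)%R).
    + apply: (measurableT_comp mf).
      by apply: measurable_funD => //; exact: measurable_cst.
  - apply: (measurableT_comp mf).
    by apply: measurable_funD => //; exact: measurable_cst.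
  - by rewrite lee_fin.
have -> : \int[mu]_x (f x * (G x)%:E) = \int[U]_v (\int[mu]_x (f x * (G x)%:E)).
  by rewrite integral_probability_cst.
have fG0 : 0 <= \int[mu]_x (f x * (G x)%:E).
  by apply: integral_ge0 => x _; rewrite mule_ge0 ?lee_fin.
rewrite !integral_uniform//; last 2 first.
- by apply: emeasurable_funD => //; exact: measurable_cst.
- by move=> x; rewrite adde_ge0// mule_ge0// lee_fin.
rewrite lee_wpmul2l// ?lee_fin ?invr_ge0 ?subr_ge0 ?(ltW aa1)//.
apply: ge0_le_integral => //.
by apply: measurable_funTS; apply: emeasurable_funD => //; exact: measurable_cst.
Qed.

End periodic.

(** * Gaussian averages and rotation invariance *)

Section gauss.
Context {R : realType}.
Local Open Scope ereal_scope.
Notation mu := (@lebesgue_measure R).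
Notation RR := (measurableTypeR R).
Notation pdf := (normal_pdf (0%R : R)).
Context (gamma : probability RR R)
  (gammaE : forall A, measurable A -> gamma A = normal_prob (0%R : R) 1%R A).

Lemma integral_stdnormalE (f : RR -> \bar R) :
  measurable_fun setT f -> (forall x, 0 <= f x) ->
  \int[gamma]_x f x = \int[mu]_x (f x * (pdf 1%R x)%:E).
Proof.
move=> mf f0; apply: ge0_integral_density; [| |exact: gammaE|by []|by []].
- exact: measurable_normal_pdf.
- by move=> x; exact: normal_pdf_ge0.
Qed.

Lemma normal_pdf0E (s x : R) : s != 0%R ->
  pdf s x = (normal_peak s * expR (- x ^+ 2 / (s ^+ 2 *+ 2)))%R.
Proof. by move=> s0; rewrite normal_pdfE// /normal_fun subr0. Qed.

Lemma normal_pdf0_le (s x y : R) : s != 0%R -> (y ^+ 2 <= x ^+ 2)%R ->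
  (pdf s x <= pdf s y)%R.
Proof.
move=> s0 xy; rewrite !normal_pdf0E// ler_wpM2l ?normal_peak_ge0//.
rewrite ler_expR ler_wpM2r ?lerN2// invr_ge0 mulrn_wge0// sqr_ge0//.
Qed.

Lemma normal_peak_scale (s : R) : s != 0%R ->
  (normal_peak (1 : R) = `|s| * normal_peak s)%R.
Proof.
move=> s0; rewrite /normal_peak expr1n mul1r -[(s ^+ 2 * pi *+ 2)%R]mulrnAr.
rewrite sqrtrM ?sqr_ge0// sqrtr_sqr invfM mulrA divff ?mul1r//.
by rewrite normr_eq0.
Qed.

Lemma normal_pdf_scale (s y : R) : s != 0%R ->
  pdf 1%R y = (`|s| * pdf s (s * y))%R.
Proof.
move=> s0; rewrite !normal_pdf0E ?oner_neq0// (normal_peak_scale s0) -mulrA.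
by congr (_ * (_ * expR _))%R; field; rewrite s0.
Qed.

Lemma integral_stdnormal_scale (f : RR -> \bar R) (x s : R) : s != 0%R ->
  measurable_fun setT f -> (forall x, 0 <= f x) ->
  \int[gamma]_y f (x + s * y)%R = \int[mu]_u (f (x + u)%R * (pdf s u)%:E).
Proof.
move=> s0 mf f0.
have mfx : measurable_fun (setT : set RR) (fun u : RR => f (x + u)%R).
  by apply: (measurableT_comp mf); apply: measurable_funD => //; exact: measurable_cst.
have mp : measurable_fun (setT : set RR) (fun u : RR => (pdf s u)%:E : \bar R).
  by apply/measurable_EFinP; exact: measurable_normal_pdf.
transitivity (\int[mu]_y (f (x + s * y)%R * (pdf 1%R y)%:E)).
  apply: (@integral_stdnormalE (fun y => f (x + s * y)%R)); last by move=> y; exact: f0.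
  apply: (measurableT_comp mf); apply: measurable_funD; first exact: measurable_cst.
  exact: measurable_funM.
transitivity (\int[mu]_y (`|s|%:E * (f (x + (s * y + 0))%R * (pdf s (s * y + 0))%:E))).
  apply: eq_integral => y _.
  by rewrite addr0 (normal_pdf_scale y s0) muleCA -EFinM.
have aff := @ge0_integral_affine R s 0 (fun u => `|s|%:E * (f (x + u)%R * (pdf s u)%:E)) s0.
rewrite aff; last 2 first.
- by apply: emeasurable_funM => //; exact: emeasurable_funM.
- by move=> y; rewrite !mule_ge0 ?lee_fin// normal_pdf_ge0.
rewrite ge0_integralZl//.
- by rewrite muleA -EFinM mulVf ?mul1e// normr_eq0.
- exact: emeasurable_funM.
- by move=> y _; rewrite mule_ge0 ?lee_fin ?normal_pdf_ge0.
Qed.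

(** The density is cut at 0 into a half [Gp] decreasing on the right and a half [Gm] increasing on
    the left. Moving either half outwards by at most 1 loses at most the peak, and only on [[0, 1]],
    respectively [[-1, 0]]. The two masses add up to 1, and the two losses to twice the peak. *)
Lemma integral_stdnormal_periodic1_le (f : RR -> \bar R) (x s : R) : s != 0%R ->
  measurable_fun setT f -> (forall x, 0 <= f x) -> periodic1 f ->
  \int[gamma]_y f (x + s * y)%R <=
  (1 + 2 * normal_peak s)%:E * \int[mu]_(x in `[0%R, 1%R]) f x.
Proof.
move=> s0 mf f0 pf; rewrite integral_stdnormal_scale//.
pose fx (u : RR) : \bar R := f (x + u)%R.
have mfx : measurable_fun (setT : set RR) fx.
  by apply: (measurableT_comp mf); apply: measurable_funD => //; exact: measurable_cst.
have pfx : periodic1 fx by move=> u; rewrite /fx addrA pf.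
have fx0 u : 0 <= fx u by exact: f0.
have Ix : \int[mu]_(u in `[0%R, 1%R]) fx u = \int[mu]_(u in `[0%R, 1%R]) f u.
  rewrite /fx; under eq_integral do rewrite addrC.
  rewrite ge0_integral_itv_translate// add0r [(1 + x)%R]addrC.
  exact: integral_periodic1.
pose Gp (u : RR) : R := (pdf s u * \1_(`[0%R, +oo[ : set RR) u)%R.
pose Gm (u : RR) : R := (pdf s u * \1_(`]-oo, 0%R[ : set RR) u)%R.
have mGp : measurable_fun (setT : set RR) Gp.
  apply: measurable_funM; first exact: measurable_normal_pdf.
  by apply: measurable_indic; exact: measurable_itv.
have mGm : measurable_fun (setT : set RR) Gm.
  apply: measurable_funM; first exact: measurable_normal_pdf.
  by apply: measurable_indic; exact: measurable_itv.
have mGpE : measurable_fun (setT : set RR) (fun u => (Gp u)%:E : \bar R).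
  exact/measurable_EFinP.
have mGmE : measurable_fun (setT : set RR) (fun u => (Gm u)%:E : \bar R).
  exact/measurable_EFinP.
have Gp0 u : (0 <= Gp u)%R by rewrite mulr_ge0 ?normal_pdf_ge0.
have Gm0 u : (0 <= Gm u)%R by rewrite mulr_ge0 ?normal_pdf_ge0.
have GpmE u : pdf s u = (Gp u + Gm u)%R.
  rewrite /Gp /Gm -mulrDr !indicE !mem_setE !in_itv/= andbT.
  by case: ltP => _; rewrite /= ?addr0 ?add0r mulr1.
have ubp : \int[mu]_u (fx u * (Gp u)%:E) <=
    (\int[mu]_u (Gp u)%:E + (normal_peak s)%:E) * \int[mu]_(u in `[0%R, 1%R]) fx u.
  apply: (@periodic1_integral_le _ fx Gp 0%R 0%R) => //; first exact: normal_peak_ge0.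
  move=> u v; rewrite add0r => /andP[v0 v1].
  rewrite /Gp !indicE !mem_setE !in_itv/= !andbT.
  have [u0|u0] := leP 0%R u; last first.
    by rewrite mulr0 addr_ge0// mulr_ge0// ?normal_pdf_ge0// normal_peak_ge0.
  have [u1|u1] := leP u 1%R.
    by rewrite !mulr1 ler_wpDl ?mulr_ge0 ?normal_pdf_ge0//; exact: normal_pdf_ub.
  have uv : (0 <= u - v)%R by rewrite subr_ge0 (le_trans v1)// ltW.
  rewrite uv !mulr1 mulr0 addr0; apply: normal_pdf0_le => //.
  by rewrite ler_sqr ?nnegrE// gerBl.
have ubm : \int[mu]_u (fx u * (Gm u)%:E) <=
    (\int[mu]_u (Gm u)%:E + (normal_peak s)%:E) * \int[mu]_(u in `[0%R, 1%R]) fx u.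
  apply: (@periodic1_integral_le _ fx Gm (-1)%R (-1)%R) => //; first exact: normal_peak_ge0.
  move=> u v; rewrite addNr => /andP[v0 v1].
  rewrite /Gm !indicE !mem_setE !in_itv/=.
  have [u0|u0] := ltP u 0%R; last first.
    by rewrite mulr0 addr_ge0// mulr_ge0// ?normal_pdf_ge0// normal_peak_ge0.
  have [u1|u1] := leP (-1)%R u.
    by rewrite (ltW u0) !mulr1 ler_wpDl ?mulr_ge0 ?normal_pdf_ge0//; exact: normal_pdf_ub.
  have uv : (u - v < 0)%R by lra.
  rewrite uv !mulr1 mulr0 addr0; apply: normal_pdf0_le => //.
  by nra.
have -> : \int[mu]_u (f (x + u)%R * (pdf s u)%:E) =
    \int[mu]_u (fx u * (Gp u)%:E) + \int[mu]_u (fx u * (Gm u)%:E).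
  rewrite -ge0_integralD//.
  - apply: eq_integral => u _; rewrite -ge0_muleDr ?lee_fin//.
    by rewrite -EFinD -GpmE.
  - by move=> u _; rewrite mule_ge0 ?lee_fin.
  - exact: emeasurable_funM.
  - by move=> u _; rewrite mule_ge0 ?lee_fin.
  - exact: emeasurable_funM.
apply: (le_trans (leeD ubp ubm)).
have Gpi0 : 0 <= \int[mu]_u (Gp u)%:E by apply: integral_ge0 => u _; rewrite lee_fin.
have Gmi0 : 0 <= \int[mu]_u (Gm u)%:E by apply: integral_ge0 => u _; rewrite lee_fin.
rewrite -ge0_muleDl; last 2 first.
- by rewrite adde_ge0// lee_fin normal_peak_ge0.
- by rewrite adde_ge0// lee_fin normal_peak_ge0.
rewrite Ix addeACA -ge0_integralD//; last 2 first.
- by move=> u _; rewrite lee_fin.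
- by move=> u _; rewrite lee_fin.
have -> : \int[mu]_u ((Gp u)%:E + (Gm u)%:E) = 1.
  rewrite -(integral_normal_pdf 0%R s).
  by apply: eq_integral => u _; rewrite -EFinD -GpmE.
by rewrite -!EFinD -mulr2n mulr_natl.
Qed.

Lemma rotation_id (c s y z : R) : c != 0%R -> (c ^+ 2 + s ^+ 2 = 1)%R ->
  (s * y + c * z = (s * (c * y - s * z) + z) / c)%R.
Proof.
move=> c0 cs1; apply: (mulIf c0); rewrite divfK//.
apply/eqP; rewrite -subr_eq0; apply/eqP.
transitivity (z * (c ^+ 2 + s ^+ 2 - 1))%R; first by ring.
by rewrite cs1 subrr mulr0.
Qed.

Lemma rotation_sum (g r s y z : R) : g != 0%R ->
  (r * y + s * z = g * (r / g * y - - s / g * z))%R.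
Proof. by move=> g0; field. Qed.

(** The rotation is chosen so that the second argument depends on [y] alone, which leaves [z] free
    to average the first argument. *)
Lemma rotation_pair (g d de be y z : R) : g != 0%R ->
  (g ^+ 2 = de ^+ 2 + be ^+ 2)%R ->
  (d + de * (de / g * y - be / g * z) + be * (be / g * y + de / g * z) =
   d + g * y)%R.
Proof.
move=> g0 g2; have -> : (g * y = g ^+ 2 / g * y)%R by rewrite expr2 mulfK.
by rewrite g2; field.
Qed.

Lemma rotation_norm (c s y z : R) :
  ((c ^+ 2 + s ^+ 2) * (- z ^+ 2 - y ^+ 2) =
   - (s * y + c * z) ^+ 2 - (c * y - s * z) ^+ 2)%R.
Proof. by ring. Qed.

Lemma normal_pdf_rotation (c s y z : R) : (c ^+ 2 + s ^+ 2 = 1)%R ->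
  (pdf 1 z * pdf 1 y = pdf 1 (s * y + c * z) * pdf 1 (c * y - s * z))%R.
Proof.
move=> cs1; rewrite !normal_pdf0E ?oner_neq0//.
rewrite mulrACA [RHS]mulrACA -!expRD; congr (_ * expR _)%R.
rewrite -!mulrDl; congr (_ / _)%R.
by rewrite -[LHS]mul1r -cs1; exact: rotation_norm.
Qed.

(** The rotation is factored into two one-dimensional affine substitutions: [u = c * y - s * z] at
    fixed [z], then [v = (s * u + z) / c] at fixed [u]. Their factors [|c|^-1] and [|c|] cancel. *)
Lemma lebesgue2_rotation (H : RR * RR -> \bar R) (c s : R) :
  measurable_fun setT H -> (forall p, 0 <= H p) ->
  c != 0%R -> (c ^+ 2 + s ^+ 2 = 1)%R ->
  \int[mu]_y \int[mu]_z H (c * y - s * z, s * y + c * z)%R =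
  \int[mu]_y \int[mu]_z H (y, z).
Proof.
move=> mH H0 c0 cs1.
have c'0 : (c^-1 != 0)%R by rewrite invr_eq0.
have m1 : measurable_fun (setT : set (RR * RR))
    (fun p : RR * RR => H (c * p.1 - s * p.2, s * p.1 + c * p.2)%R).
  apply: (measurableT_comp mH); apply: measurable_fun_pair => /=.
    by apply: measurable_funB; exact: measurable_funM.
  by apply: measurable_funD; exact: measurable_funM.
have m2 : measurable_fun (setT : set (RR * RR))
    (fun p : RR * RR => H (p.1, (s * p.1 + p.2) / c)%R).
  apply: (measurableT_comp mH); apply: measurable_fun_pair => //=.
  apply: measurable_funM; last exact: measurable_cst.
  apply: measurable_funD; last exact: measurable_snd.
  exact: measurable_funM.
rewrite (fubini_tonelli _ m1 (fun=> H0 _))/=.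
have Kz (z : R) : \int[mu]_y H (c * y - s * z, s * y + c * z)%R =
    (`|c|^-1)%:E * \int[mu]_u H (u, (s * u + z) / c)%R.
  have := @ge0_integral_affine R c (- (s * z)) (fun u => H (u, (s * u + z) / c)%R) c0.
  move=> <-; last 2 first.
  - exact: (measurableT_comp m2 (pair2_measurable z)).
  - by move=> u; exact: H0.
  by apply: eq_integral => y _; congr (H (_, _)); exact: rotation_id.
under eq_integral do rewrite Kz.
rewrite ge0_integralZl//; last 2 first.
- exact: (measurable_fun_fubini_tonelli_G _ m2 (fun=> H0 _)).
- by move=> z _; apply: integral_ge0 => u _; exact: H0.
rewrite -(fubini_tonelli _ m2 (fun=> H0 _))/=.
have Ku (u : R) : \int[mu]_z H (u, (s * u + z) / c)%R =
    `|c|%:E * \int[mu]_v H (u, v).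
  have := @ge0_integral_affine R c^-1 (s * u / c) (fun v => H (u, v)) c'0.
  rewrite normfV invrK => <-; last 2 first.
  - by apply: (measurableT_comp mH); exact: pair1_measurable.
  - by move=> v; exact: H0.
  apply: eq_integral => z _; congr (H (_, _)).
  by rewrite mulrDl addrC [(z / c)%R]mulrC.
under eq_integral do rewrite Ku.
rewrite ge0_integralZl//.
- by rewrite muleA -EFinM mulVf ?mul1e// normr_eq0.
- exact: (measurable_fun_fubini_tonelli_F _ mH H0).
- by move=> z _; apply: integral_ge0 => u _; exact: H0.
Qed.

(** The product of the two densities is a function of the Euclidean norm, so the invariance of
    Lebesgue measure passes to the Gaussian one. *)
Lemma stdnormal2_rotation (F : RR * RR -> \bar R) (c s : R) :
  measurable_fun setT F -> (forall p, 0 <= F p) ->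
  c != 0%R -> (c ^+ 2 + s ^+ 2 = 1)%R ->
  \int[gamma]_y \int[gamma]_z F (c * y - s * z, s * y + c * z)%R =
  \int[gamma]_y \int[gamma]_z F (y, z).
Proof.
move=> mF F0 c0 cs1.
have stdE (K : RR * RR -> \bar R) : measurable_fun setT K -> (forall p, 0 <= K p) ->
    \int[gamma]_y \int[gamma]_z K (y, z) =
    \int[mu]_y \int[mu]_z (K (y, z) * (pdf 1 z * pdf 1 y)%:E).
  move=> mK K0; rewrite integral_stdnormalE; last 2 first.
  - exact: (measurable_fun_fubini_tonelli_F _ mK K0).
  - by move=> y; exact: integral_ge0.
  apply: eq_integral => y _; rewrite integral_stdnormalE//; last first.
    by apply: (measurableT_comp mK); exact: pair1_measurable.
  rewrite -ge0_integralZr//.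
  - by apply: eq_integral => z _; rewrite -muleA -EFinM.
  - apply: emeasurable_funM.
      by apply: (measurableT_comp mK); exact: pair1_measurable.
    by apply/measurable_EFinP; exact: measurable_normal_pdf.
  - by move=> z _; rewrite mule_ge0 ?lee_fin ?normal_pdf_ge0.
  - by rewrite lee_fin normal_pdf_ge0.
rewrite (stdE (fun p => F (c * p.1 - s * p.2, s * p.1 + c * p.2)%R))//; last first.
  apply: (measurableT_comp mF); apply: measurable_fun_pair => /=.
    by apply: measurable_funB; exact: measurable_funM.
  by apply: measurable_funD; exact: measurable_funM.
rewrite (stdE F mF F0).
have mpdf : measurable_fun (setT : set RR) (pdf 1%R) by exact: measurable_normal_pdf.
apply: etrans; last first.
  apply: (@lebesgue2_rotation (fun p => F p * (pdf 1 p.2 * pdf 1 p.1)%:E) c s) => //.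
  - apply: emeasurable_funM => //; apply/measurable_EFinP.
    by apply: measurable_funM; exact: (measurableT_comp mpdf).
  - by move=> p; rewrite mule_ge0// lee_fin mulr_ge0// normal_pdf_ge0.
apply: eq_integral => y _; apply: eq_integral => z _; congr (_ * _%:E).
exact: normal_pdf_rotation.
Qed.

(** A rotation turns [r * y + s * z] into the first coordinate times [g], the root of
    [r ^+ 2 + s ^+ 2]. Its cosine is [r / g], so [r = 0] is treated apart. *)
Lemma stdnormal_convolution (f : RR -> \bar R) (x r s : R) :
  measurable_fun setT f -> (forall x, 0 <= f x) -> (0 <= s)%R ->
  \int[gamma]_y \int[gamma]_z f (x + r * y + s * z)%R =
  \int[gamma]_y f (x + Num.sqrt (r ^+ 2 + s ^+ 2) * y)%R.
Proof.
move=> mf f0 s0; have [->|r0] := eqVneq r 0%R.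
  rewrite expr0n/= add0r sqrtr_sqr ger0_norm//.
  under eq_integral do rewrite mul0r addr0.
  by rewrite integral_probability_cst.
set g := Num.sqrt _.
have g2 : (g ^+ 2 = r ^+ 2 + s ^+ 2)%R by rewrite sqr_sqrtr// addr_ge0 ?sqr_ge0.
have g0 : (g != 0)%R.
  rewrite gt_eqF// sqrtr_gt0 ltr_pwDl ?sqr_ge0// exprn_even_gt0//.
have := @stdnormal2_rotation (fun p => f (x + g * p.1)%R) (r / g)%R (- s / g)%R.
move=> rot; transitivity (\int[gamma]_y \int[gamma]__ f (x + g * y)%R); last first.
  by apply: eq_integral => y _; rewrite integral_probability_cst.
rewrite -rot.
- apply: eq_integral => y _; apply: eq_integral => z _; congr f.
  by rewrite /= -addrA; congr (_ + _)%R; exact: rotation_sum.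
- apply: (measurableT_comp mf); apply: measurable_funD; first exact: measurable_cst.
  exact: measurable_funM.
- by move=> p; exact: f0.
- by rewrite mulf_neq0// invr_eq0.
- by rewrite !exprMn sqrrN -mulrDl -g2 exprVn divff// expf_neq0.
Qed.

Lemma measurable_integral_fst01 (F : RR * RR -> \bar R) :
  measurable_fun setT F -> (forall p, 0 <= F p) ->
  measurable_fun (setT : set RR) (fun e => \int[mu]_(x in `[0%R, 1%R]) F (x, e)).
Proof.
move=> mF F0.
have -> : (fun e => \int[mu]_(x in `[0%R, 1%R]) F (x, e)) =
    fubini_G mu (fun p : RR * RR => F p * (\1_(`[0%R, 1%R] : set RR) p.1)%:E).
  apply/funext => e; rewrite /fubini_G [LHS]integral_mkcond/=.
  by apply: eq_integral => y _; rewrite epatch_indic.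
apply: measurable_fun_fubini_tonelli_G; last first.
  by move=> p; rewrite mule_ge0 ?lee_fin.
apply: emeasurable_funM => //; apply/measurable_EFinP.
apply: (measurableT_comp _ measurable_fst).
by apply: measurable_indic; exact: measurable_itv.
Qed.

(** Both sides are rotated by the angle with cosine [de / g] and sine [be / g]. The second argument
    of [F] becomes [d + g * y], while [z] moves the first one with coefficient [- (al * be / g)];
    the one-dimensional bound is then applied in [z] for each [y]. *)
Lemma stdnormal2_periodic1_le (F : RR * RR -> \bar R) (x d al de be : R) :
  measurable_fun setT F -> (forall p, 0 <= F p) ->
  (forall d, periodic1 (fun x => F (x, d))) ->
  al != 0%R -> de != 0%R -> be != 0%R ->
  \int[gamma]_y \int[gamma]_z F (x + al * y, d + de * y + be * z)%R <=
  (1 + 2 * normal_peak (al * be / Num.sqrt (de ^+ 2 + be ^+ 2)))%:E *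
  \int[gamma]_y \int[gamma]_z
     \int[mu]_(x in `[0%R, 1%R]) F (x, d + de * y + be * z)%R.
Proof.
move=> mF F0 pF al0 de0 be0.
set g := Num.sqrt _.
have g2 : (g ^+ 2 = de ^+ 2 + be ^+ 2)%R by rewrite sqr_sqrtr// addr_ge0 ?sqr_ge0.
have g0 : (g != 0)%R.
  rewrite gt_eqF// sqrtr_gt0 ltr_pwDl ?sqr_ge0// exprn_even_gt0//.
pose psi (e : RR) : \bar R := \int[mu]_(x in `[0%R, 1%R]) F (x, e).
have mpsi : measurable_fun (setT : set RR) psi by exact: measurable_integral_fst01.
have psi0 e : 0 <= psi e by exact: integral_ge0.
have cs1 : ((de / g) ^+ 2 + (be / g) ^+ 2 = 1)%R.
  by rewrite !exprMn -mulrDl -g2 exprVn divff// expf_neq0.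
have c0 : (de / g != 0)%R by rewrite mulf_neq0// invr_eq0.
have m2 (a1 b1 a2 b2 c1 c2 : R) : measurable_fun (setT : set (RR * RR))
    (fun p : RR * RR => (c1 + a1 * p.1 + b1 * p.2, c2 + a2 * p.1 + b2 * p.2)%R : RR * RR).
  by apply: measurable_fun_pair => /=; apply: measurable_funD;
    rewrite ?[X in measurable_fun _ X]/=; try (exact: measurable_funM);
    apply: measurable_funD; try (exact: measurable_cst); exact: measurable_funM.
rewrite -(@stdnormal2_rotation
  (fun p => F (x + al * p.1, d + de * p.1 + be * p.2)%R) _ _ _ _ c0 cs1)//=;
  last first.
  apply: (measurableT_comp mF).
  have := m2 al 0%R de be x d; apply: eq_measurable_fun => p _.
  by rewrite mul0r addr0.
rewrite -(@stdnormal2_rotation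
  (fun p => psi (d + de * p.1 + be * p.2)%R) _ _ _ _ c0 cs1)//=; last first.
  apply: (measurableT_comp mpsi).
  exact: (measurableT_comp measurable_snd (m2 0%R 0%R de be 0%R d)).
have E (y z : R) := rotation_pair d y z g0 g2.
under [X in _ <= _ * X]eq_integral.
  move=> y _; under eq_integral do rewrite E.
  rewrite integral_probability_cst; over.
rewrite -ge0_integralZl//; last 2 first.
- apply: (measurableT_comp mpsi); apply: measurable_funD; first exact: measurable_cst.
  exact: measurable_funM.
- by rewrite lee_fin addr_ge0// mulr_ge0// normal_peak_ge0.
apply: ge0_le_integral => //.
- by move=> y _; exact: integral_ge0.
- have := measurable_fun_fubini_tonelli_F (m2 := gamma)
    (fun p : RR * RR => F (x + al * (de / g * p.1 - be / g * p.2), d + g * p.1)%R).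
  move=> /(_ _)/(_ _) H.
  under eq_fun do under eq_integral do rewrite E.
  apply: H => //; apply: (measurableT_comp mF).
  have := m2 (al * (de / g))%R (- (al * (be / g)))%R g 0%R x d.
  apply: eq_measurable_fun => p _; congr (_, _); first by ring.
  by ring.
- apply: emeasurable_funM; first exact: measurable_cst.
  apply: (measurableT_comp mpsi); apply: measurable_funD; first exact: measurable_cst.
  exact: measurable_funM.
move=> y _; under eq_integral do rewrite E.
have -> : normal_peak (al * be / g) = normal_peak (- (al * be / g)) by rewrite /normal_peak sqrrN.
under eq_integral.
  move=> z _.
  have -> : (x + al * (de / g * y - be / g * z) =
    x + al * (de / g * y) + (- (al * be / g)) * z)%R by field.
  over.
apply: (@integral_stdnormal_periodic1_le (fun u => F (u, d + g * y)%R)) => //.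
- by rewrite oppr_eq0 mulf_neq0 ?invr_eq0// mulf_neq0.
- by apply: (measurableT_comp mF); exact: pair2_measurable.
Qed.

End gauss.

(** * Partial sums of the fractional coefficients *)

Section coefficients.
Context {R : realType} (a : R) (a_itv : - 2^-1 < a < 2^-1) (eta : nat -> R).
(** The two hypotheses characterize the coefficients of [(1 - z)^(- a)], including [a = 0], where
    they give the sequence 1, 0, 0, and so on. *)
Hypothesis eta0 : eta 0%N = 1.
Hypothesis etaS : forall n, n.+1%:R * eta n.+1 = (n%:R + a) * eta n.

Definition psum (u : nat -> R) (m : nat) := \sum_(0 <= i < m.+1) u i.

Lemma psum0 u : psum u 0 = u 0%N.
Proof. by rewrite /psum big_nat1. Qed.

Lemma psumS u m : psum u m.+1 = psum u m + u m.+1.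
Proof. by rewrite /psum big_nat_recr. Qed.

(** Each summation multiplies the generating function by [(1 - z)^-1]: [s] belongs to the exponent
    [- (a + 1)] and [c] to [- (a + 2)]. *)
Let s := psum eta.
Let c := psum s.

Let sE m : a * s m = m.+1%:R * eta m.+1.
Proof.
elim: m => [|m IH]; first by rewrite /s psum0 etaS eta0 add0r.
by rewrite /s psumS mulrDr -/s IH -mulrDl etaS.
Qed.

Let sS m : m.+1%:R * s m.+1 = (m.+1%:R + a) * s m.
Proof. by rewrite {1}/s psumS -/s mulrDr -sE -mulrDl. Qed.

(** For [a < 0] the terms [eta n] are negative from [n = 1] on; their partial sums stay positive
    since each is the previous one times [(m + 1 + a) / (m + 1)]. *)
Let s_gt0 m : 0 < s m.
Proof.
elim: m => [|m IH]; first by rewrite /s psum0 eta0.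
have m1 : 0 < m.+1%:R :> R by [].
rewrite -(pmulr_rgt0 _ m1) sS mulr_gt0//.
have : 1 <= m.+1%:R :> R by rewrite ler1n.
by move/andP: a_itv => [a1 _]; lra.
Qed.

Let cE m : (a + 1) * c m = m.+1%:R * s m.+1.
Proof.
elim: m => [|m IH].
  by rewrite /c psum0 sS addrC.
rewrite /c psumS mulrDr -/c IH -mulrDl [RHS]sS; congr (_ * _).
by rewrite -[m.+2%:R]natr1; ring.
Qed.

Lemma psum2_gt0 m : 0 < c m.
Proof.
elim: m => [|m IH]; first by rewrite /c psum0.
by rewrite /c psumS -/c addr_gt0.
Qed.

(** The right side starts at [1 + a] and is nondecreasing in [m] because [1 + a > 0]. Comparison
    with the harmonic series then makes [c] diverge. *)
Let s_ge m : 2^-1 <= m.+1%:R * s m.+1.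
Proof.
elim: m => [|m IH].
  by rewrite sS /s psum0 eta0 mulr1; move/andP: a_itv => [a1 _]; lra.
apply: (le_trans IH); rewrite [leRHS]sS ler_wpM2r ?ltW//.
by rewrite -[m.+2%:R]natr1; move/andP: a_itv => [a1 _]; lra.
Qed.

(** Here [a > - 1/2] is decisive: with [x = m + 1], the right side is nondecreasing because
    [(x + 1 + a)^2 >= x * (x + 1)], which follows from [1 + 2 * a > 0]. *)
Let s2_ge m : 4^-1 <= m.+1%:R * s m.+1 ^+ 2.
Proof.
elim: m => [|m IH].
  have := s_ge 0; rewrite !mul1r => h.
  by have := s_gt0 1; nra.
apply: (le_trans IH).
have x0 : 0 < m.+2%:R :> R by [].
rewrite -(ler_pM2l x0) [leRHS]mulrA.
have -> : m.+2%:R * m.+2%:R * s m.+2 ^+ 2 = ((m.+2%:R + a) * s m.+1) ^+ 2.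
  by rewrite -sS; ring.
rewrite exprMn mulrA.
rewrite ler_wpM2r ?sqr_ge0//.
rewrite -[m.+2%:R]natr1; move/andP: a_itv => [a1 _].
have : 0 < m.+1%:R :> R by [].
by move: (m.+1%:R) => x x00; nra.
Qed.

Let harmonic_dvg (u : nat -> R) (k : R) : 0 < k ->
  (forall n, k * series harmonic n <= u n) -> u n @[n --> \oo] --> +oo.
Proof.
move=> k0 ku; apply/cvgryPge => A.
have nd : nondecreasing_seq (series (@harmonic R)).
  by apply: nondecreasing_series => n _ _; exact: harmonic_ge0.
have /cvgryPge/(_ (A / k)) := nondecreasing_dvgn_lt nd (@dvg_harmonic R).
apply: filterS => n An; apply: le_trans (ku n).
by rewrite mulrC -ler_pdivrMr.
Qed.

Lemma psum2_cvgy : c n @[n --> \oo] --> +oo.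
Proof.
apply: (@harmonic_dvg _ 2^-1) => // n.
elim: n => [|n IH].
  by rewrite /series/= big_geq// mulr0 ltW// psum2_gt0.
rewrite seriesS addrC mulrDr /c psumS -/c; apply: lerD => //.
rewrite /harmonic/= ler_pdivrMr// mulrC.
exact: s_ge.
Qed.

(** Up to the factor [Delta^-1], this is the coefficient of the noise of index [n - l] in the
    increment of the state from [n] to [n + k]. *)
Definition gap k l := c (l + k)%N - c l.

Let gap_ge k l : (0 < k)%N -> s l.+1 <= gap k l.
Proof.
case: k => // k _; elim: k => [|k IH].
  by rewrite /gap addn1 /c psumS -/c addrC addKr.
apply: (le_trans IH); rewrite /gap lerD2r.
have -> : c (l + k.+2) = c (l + k.+1) + s (l + k.+2) by rewrite (addnS l k.+1) /c psumS.
by rewrite lerDl ltW.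
Qed.

Lemma gap_gt0 k l : (0 < k)%N -> 0 < gap k l.
Proof. by move=> k0; apply: lt_le_trans (gap_ge l k0). Qed.

(** A gap is at least its first summand [s l.+1], whose square is at least a quarter of the harmonic
    term. *)
Lemma gap_square_cvgy k : (0 < k)%N ->
  \sum_(0 <= l < n) gap k l ^+ 2 @[n --> \oo] --> +oo.
Proof.
move=> k0; apply: (@harmonic_dvg _ 4^-1) => // n.
elim: n => [|n IH]; first by rewrite /series/= !big_geq// mulr0.
rewrite seriesS addrC mulrDr big_nat_recr//=; apply: lerD => //.
rewrite /harmonic/= ler_pdivrMr// mulrC.
apply: (le_trans (s2_ge n)); rewrite ler_wpM2l//.
apply: lerXn2r; rewrite ?nnegrE ?(ltW (s_gt0 _)) ?(ltW (gap_gt0 _ k0))//.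
exact: gap_ge.
Qed.

(** A gap consists of [k] values of [s], each at most [2 ^+ k * s l.+1] since [s] at most doubles at
    a step. By [cE], [l.+1 * s l.+1 = (a + 1) * c l], and [a + 1 <= 2]. Thus the gap is of order
    [c l / l]. *)
Let gap_le k l : (l.+1)%:R * gap k l <= k%:R * 2 ^+ k * 2 * c l.
Proof.
have s_le i m : s (m + i)%N <= 2 ^+ i * s m.
  elim: i => [|i IH]; first by rewrite addn0 expr0 mul1r.
  rewrite addnS exprS -mulrA; apply: (@le_trans _ _ (2 * s (m + i)%N)); last first.
    by rewrite ler_wpM2l.
  have x0 : 0 < (m + i).+1%:R :> R by [].
  rewrite -(ler_pM2l x0) sS mulrA ler_wpM2r ?ltW//.
  have : 1 <= (m + i).+1%:R :> R by rewrite ler1n.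
  by move/andP: a_itv => [_ a1]; lra.
have g_le : gap k l <= k%:R * 2 ^+ k * s l.+1.
  suff H i : (i <= k)%N -> gap i l <= i%:R * 2 ^+ k * s l.+1 by exact: H.
  elim: i => [_|i IH ik]; first by rewrite /gap addn0 subrr !mul0r.
  rewrite /gap addnS /c psumS -/c addrAC -natr1 !mulrDl mul1r.
  apply: lerD; first exact/IH/ltnW.
  rewrite -addSn; apply: (le_trans (s_le i l.+1)).
  by rewrite ler_wpM2r ?(ltW (s_gt0 _))// ler_weXn2l ?ler1n// ltnW.
have x0 : 0 < l.+1%:R :> R by [].
apply: (@le_trans _ _ (l.+1%:R * (k%:R * 2 ^+ k * s l.+1))).
  by rewrite ler_wpM2l.
rewrite mulrCA -cE -!mulrA ler_wpM2l// ler_wpM2l ?exprn_ge0//.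
rewrite ler_wpM2r ?ltW ?psum2_gt0//.
by move/andP: a_itv => [_ a1]; lra.
Qed.

(** Up to [Delta], the ratio is the inverse of the standard deviation that the rotation makes
    available for averaging the state. The root is at most [1 + gap k n], so the ratio is at most
    [1 / c n] plus a multiple of the harmonic term. *)
Lemma gap_ratio_cvg0 k :
  Num.sqrt (gap k n ^+ 2 + 1) / c n @[n --> \oo] --> 0.
Proof.
have [->|k0] := posnP k.
  under eq_fun do rewrite /gap addn0 subrr expr0n/= add0r sqrtr1 mul1r.
  by apply/gtr0_cvgV0; [near=> n; exact: psum2_gt0|exact: psum2_cvgy].
apply: (@squeeze_cvgr _ _ _ _ (cst 0) (fun n => (c n)^-1 + k%:R * 2 ^+ k * 2 * harmonic n)).
- near=> n; rewrite divr_ge0 ?sqrtr_ge0 ?(ltW (psum2_gt0 _))//=.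
  rewrite ler_pdivrMr ?psum2_gt0// mulrDl mulVf ?gt_eqF ?psum2_gt0//.
  apply: (@le_trans _ _ (1 + gap k n)).
    have g0 := gap_gt0 n k0.
    have e : 1 + gap k n = Num.sqrt ((1 + gap k n) ^+ 2).
      by rewrite sqrtr_sqr ger0_norm// addr_ge0// ltW.
    by rewrite e ler_sqrt ?sqr_ge0//; nra.
  rewrite lerD2l /harmonic/= mulrAC ler_pdivlMr// mulrC.
  exact: gap_le.
- exact: cvg_cst.
- rewrite -[X in _ --> X](addr0 0); apply: cvgD.
    by apply/gtr0_cvgV0; [near=> n; exact: psum2_gt0|exact: psum2_cvgy].
  rewrite -(mulr0 (k%:R * 2 ^+ k * 2)); apply: cvgMr; exact: cvg_harmonic.
Unshelve. all: by end_near. Qed.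

End coefficients.

(** * The Gamma function *)

Section gamma_function.
Context {R : realType}.
Local Open Scope ereal_scope.
Notation mu := (@lebesgue_measure R).
Notation RR := (measurableTypeR R).

Definition gamma_fun (x s : R) : R := (s `^ (x - 1) * expR (- s))%R.

(* Extended-real valued, so that the functional equation is available before, and
   used for, the proof of finiteness. *)
Definition egamma (x : R) : \bar R :=
  \int[mu]_(s in `]0%R, +oo[) (gamma_fun x s)%:E.

Lemma gamma_fun_ge0 x s : (0 <= gamma_fun x s)%R.
Proof. by rewrite mulr_ge0 ?powR_ge0 ?expR_ge0. Qed.

Lemma measurable_gamma_fun x : measurable_fun (setT : set RR) (gamma_fun x).
Proof.
apply: measurable_funM; first exact: measurable_powR.
exact: (measurableT_comp (@measurable_expR R) (@oppr_measurable R setT)).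
Qed.

Lemma measurable_egamma_fun x (D : set RR) : measurable_fun D (EFin \o gamma_fun x).
Proof. by apply/measurable_EFinP/measurable_funTS; exact: measurable_gamma_fun. Qed.

Lemma egamma_ge0 x : 0 <= egamma x.
Proof. by apply: integral_ge0 => s _; rewrite lee_fin gamma_fun_ge0. Qed.

(** Compact intervals that exhaust []0, +oo[], on which integration by parts applies. *)
Let F (n : nat) : set RR := `[(n.+2%:R^-1)%R, n.+2%:R].

Let bigcupF : \bigcup_n F n = `]0%R, +oo[%classic.
Proof.
apply/seteqP; split => s /=.
  move=> [n _]; rewrite /F/= !in_itv/= andbT => /andP[h _].
  by apply: lt_le_trans h.
rewrite in_itv/= andbT => s0.
exists (maxn (Num.truncn s) (Num.truncn s^-1)) => //.
rewrite /F/= in_itv/=; set m := maxn _ _; apply/andP; split.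
  rewrite invf_ple ?posrE//; apply: (le_trans (ltW (truncnS_gt s^-1))).
  by rewrite ler_nat ltnS; apply: leqW; exact: leq_maxr.
apply: (le_trans (ltW (truncnS_gt s))).
by rewrite ler_nat ltnS; apply: leqW; exact: leq_maxl.
Qed.

Let cvgF (f : RR -> \bar R) : measurable_fun setT f -> (forall x, 0 <= f x) ->
  \int[mu]_(s in F n) f s @[n --> \oo] --> \int[mu]_(s in `]0%R, +oo[) f s.
Proof.
move=> mf f0; rewrite -bigcupF; apply: ge0_nondecreasing_set_cvg_integral => //.
- move=> n m nm; rewrite subsetEset => s; rewrite /F/= !in_itv/= => /andP[h1 h2].
  apply/andP; split; last by rewrite (le_trans h2)// ler_nat !ltnS.
  by rewrite (le_trans _ h1)// lef_pV2 ?posrE// ler_nat !ltnS.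
- by move=> n; exact: measurable_itv.
- by move=> n; exact: measurable_funTS.
Qed.

Lemma powR_expRN_le (x : R) : exists K : R,
  forall s, (1 <= s)%R -> (s `^ x * expR (- s) <= K / s)%R.
Proof.
pose N := (Num.truncn x).+1.
exists (N.+1%:R ^+ N.+1)%R => s s1.
have s0 : (0 < s)%R by apply: lt_le_trans s1.
have sN : (s `^ x <= s ^+ N)%R.
  rewrite -powR_mulrn ?(ltW s0)//; apply: ler_powR => //.
  exact/ltW/truncnS_gt.
rewrite ler_pdivlMr// mulrAC expRN ler_pdivrMr ?expR_gt0//.
apply: (@le_trans _ _ (s ^+ N.+1)%R); first by rewrite exprSr ler_wpM2r// ltW.
have -> : s = (N.+1%:R * (s / N.+1%:R))%R by field.
rewrite expRM_natl exprMn ler_wpM2l ?exprn_ge0//.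
apply: lerXn2r; rewrite ?nnegrE ?expR_ge0 ?divr_ge0 ?(ltW s0)//.
by rewrite (le_trans _ (expR_ge1Dx _))// lerDr.
Qed.

Lemma egammaD1 (x : R) : (0 < x)%R -> egamma (x + 1)%R = x%:E * egamma x.
Proof.
move=> x0.
pose Phi (s : R) := (expR (- s) * s `^ x)%R.
have parts n : \int[mu]_(s in F n) (x * gamma_fun x s)%:E =
    (Phi n.+2%:R - Phi n.+2%:R^-1)%:E + \int[mu]_(s in F n) (gamma_fun (x + 1) s)%:E.
  have ab : (n.+2%:R^-1 < n.+2%:R :> R)%R.
    by rewrite (@lt_trans _ _ 1%R)// ?invf_lt1// ltr1n.
  have a0 : (0 < n.+2%:R^-1 :> R)%R by rewrite invr_gt0.
  have dp (y s : R) : (0 < s)%R -> {for s, continuous (fun s => s `^ y)%R}.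
    move=> s0; apply/differentiable_continuous/derivable1_diffP.
    by apply: derivable_powR; rewrite in_itv/= andbT.
  have cE : continuous (fun s : R => expR (- s)).
    by move=> s; apply: continuous_comp; [exact: opp_continuous|exact: continuous_expR].
  have := @integration_by_parts R (fun s => expR (- s)) (fun s => s `^ x)%R
    (fun s => - expR (- s))%R (fun s => x * s `^ (x - 1))%R _ _ ab.
  move=> parts.
  rewrite (_ : \int[mu]_(s in F n) (x * gamma_fun x s)%:E =
     \int[mu]_(s in `[(n.+2%:R^-1)%R, n.+2%:R]) (expR (- s) * (x * s `^ (x - 1)))%:E); last first.
    by apply: eq_integral => s _; rewrite /gamma_fun; congr EFin; ring.
  rewrite parts /Phi.
  - rewrite (_ : \int[mu]_(s in `[(n.+2%:R^-1)%R, n.+2%:R]) (- expR (- s) * s `^ x)%:E =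
      - \int[mu]_(s in F n) (gamma_fun (x + 1) s)%:E) ?oppeK//.
    rewrite -integral_ge0N; last by move=> s _; rewrite lee_fin gamma_fun_ge0.
    apply: eq_integral => s _; rewrite /gamma_fun addrK -EFinN; congr EFin.
    by rewrite mulNr mulrC.
  - apply: continuous_subspaceT => s; apply: cvgN; exact: cE.
  - split.
    + by move=> s _; exact: ex_derive.
    + by apply/cvg_at_right_filter; exact: cE.
    + by apply/cvg_at_left_filter; exact: cE.
  - move=> s _; rewrite derive1_comp// derive1N// derive1_id mulrN1 derive1E.
    by have /funeqP -> := @derive_expR R.
  - apply: continuous_in_subspaceT => s; rewrite inE/= in_itv/= => /andP[as_ _].
    have s0 : (0 < s)%R by apply: lt_le_trans as_.
    by apply: cvgMr; exact: dp.
  - split.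
    + move=> s; rewrite in_itv/= => /andP[as_ _].
      by apply: derivable_powR; rewrite in_itv/= andbT (lt_trans a0).
    + by apply/cvg_at_right_filter; exact: dp.
    + by apply/cvg_at_left_filter; apply: dp; rewrite (lt_trans a0).
  - move=> s; rewrite in_itv/= => /andP[as_ _].
    by apply: powR_derive1; rewrite in_itv/= andbT (lt_trans a0).
have Phi_ge0 s : (0 <= Phi s)%R by rewrite mulr_ge0 ?powR_ge0 ?expR_ge0.
have shift2 (u : nat -> R) (l : R) : u n @[n --> \oo] --> l -> u n.+1 @[n --> \oo] --> l.
  by move=> ul; have := cvg_shiftS u (nbhs l); rewrite propeqE => -[_]; apply.
have Phib : Phi n.+2%:R @[n --> \oo] --> (0 : R)%R.
  have [K HK] := powR_expRN_le x.
  apply: (@squeeze_cvgr _ _ _ _ (cst 0%R) (fun n => K * harmonic n.+1)%R).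
  - apply: nearW => n; rewrite Phi_ge0/= /Phi mulrC.
    by apply: HK; rewrite ler1n.
  - exact: cvg_cst.
  - rewrite -(mulr0 K); apply: cvgMr; apply: shift2; exact: cvg_harmonic.
have a_cvg : (n.+2%:R^-1)%R @[n --> \oo] --> (0 : R)%R.
  exact: (shift2 _ _ (@cvg_harmonic R)).
have Phia : Phi (n.+2%:R^-1)%R @[n --> \oo] --> (0 : R)%R.
  apply: (@squeeze_cvgr _ _ _ _ (cst 0%R) (fun n => n.+2%:R^-1 `^ x)%R).
  - apply: nearW => n; rewrite Phi_ge0/= /Phi ler_piMl ?powR_ge0//.
  - exact: cvg_cst.
  - apply: (@cvg_comp _ _ _ (fun n => n.+2%:R^-1 : R)%R
      (fun s => s `^ x)%R _ (0%R : R)^'+); last exact: powR_cvg0.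
    move=> A [e /= e0 eA]; move/cvgrPdist_lt : a_cvg => /(_ e e0).
    by apply: filterS => n ne; apply: eA => //=; rewrite invr_gt0.
have mx : measurable_fun (setT : set RR) (fun s => (x * gamma_fun x s)%:E).
  by apply/measurable_EFinP; apply: measurable_funM => //; exact: measurable_gamma_fun.
have cB := cvgF mx _.
have cA := cvgF (@measurable_egamma_fun (x + 1)%R setT) _.
have {}cB : \int[mu]_(s in F n) (x * gamma_fun x s)%:E @[n --> \oo] --> x%:E * egamma x.
  have -> : x%:E * egamma x = \int[mu]_(s in `]0%R, +oo[) (x * gamma_fun x s)%:E.
    rewrite /egamma -ge0_integralZl//.
    + exact: measurable_egamma_fun.
    + by move=> s _; rewrite lee_fin gamma_fun_ge0.
    + by rewrite lee_fin ltW.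
  by apply: cB => s; rewrite lee_fin mulr_ge0 ?gamma_fun_ge0// ltW.
have {}cA : \int[mu]_(s in F n) (gamma_fun (x + 1) s)%:E @[n --> \oo] --> egamma (x + 1)%R.
  by apply: cA => s; rewrite lee_fin gamma_fun_ge0.
have cP : (Phi n.+2%:R - Phi n.+2%:R^-1)%:E @[n --> \oo] --> (0 : \bar R).
  apply/fine_cvgP; split; first exact: nearW.
  by rewrite -[X in _ --> X](subrr (0 : R)%R); exact: cvgB.
rewrite -(cvg_lim (@ereal_hausdorff R) cB); apply/esym/cvg_lim => //.
under eq_fun do rewrite parts.
by rewrite -[egamma (x + 1)%R]add0e; apply: cvgeD.
Qed.

(** The integrand is the density of the exponential law of rate 1. *)
Lemma egamma1 : egamma 1%R = 1.
Proof.
rewrite -(@integral_exponential_pdf R 1 ltr01) /egamma.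
rewrite [RHS](_ : _ = \int[mu]_(s in `[0%R, +oo[) (exponential_pdf 1%R s)%:E); last first.
  rewrite [RHS]integral_mkcond; apply: eq_integral => s _; rewrite patchE.
  by case: ifPn => // h; rewrite /exponential_pdf patchE (negbTE h).
rewrite -(@integral_itv_obnd_cbnd R 0%R +oo%O); last first.
  apply/measurable_funTS/measurable_EFinP; exact: measurable_exponential_pdf.
apply: eq_integral => s; rewrite inE/= in_itv/= andbT => s0.
rewrite /gamma_fun subrr powRr0 mul1r exponential_pdfE ?ltW//.
by rewrite mul1r mulN1r.
Qed.

(** For an argument at least 1 the integrand is at least [expR (- 2)] on [[1, 2]]; the functional
    equation brings any positive [x] to this case. *)
Lemma egamma_gt0 (x : R) : (0 < x)%R -> 0 < egamma x.
Proof.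
have ge1 (y : R) : (1 <= y)%R -> 0 < egamma y.
  move=> y1; apply: (@lt_le_trans _ _ (\int[mu]_(s in `[1%R, 2%R]) (expR (- 2))%:E)).
    rewrite integral_cst//= lebesgue_measure_itv/= lte_fin ltr1n.
    by rewrite -EFinB -EFinM lte_fin mulr_gt0 ?expR_gt0// subr_gt0 ltr1n.
  apply: (@le_trans _ _ (\int[mu]_(s in `[1%R, 2%R]) (gamma_fun y s)%:E)).
    apply: ge0_le_integral => //.
    - exact: measurable_egamma_fun.
    - move=> s /=; rewrite in_itv/= => /andP[s1 s2]; rewrite lee_fin.
      rewrite -[leLHS]mul1r ler_pM ?expR_ge0// ?ler_expR ?lerN2//.
      have := @ler_powR _ s s1 0%R (y - 1)%R; rewrite powRr0; apply.
      by rewrite subr_ge0.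
  apply: ge0_subset_integral => //.
  - exact: measurable_egamma_fun.
  - by move=> s _; rewrite lee_fin gamma_fun_ge0.
  - move=> s /=; rewrite !in_itv/= andbT => /andP[s1 _].
    by apply: lt_le_trans s1.
move=> x0; have := ge1 (x + 1)%R; rewrite lerDr (ltW x0) egammaD1// => /(_ isT).
by rewrite pmule_rgt0// lte_fin.
Qed.

Lemma egamma_fin (x : R) : (0 < x)%R -> egamma x < +oo.
Proof.
have le1 (y : R) : (0 < y <= 1)%R -> egamma y < +oo.
  move=> /andP[y0 y1].
  have : egamma (y + 1)%R < +oo.
    apply: (@le_lt_trans _ _ (egamma 1%R + egamma (1 + 1)%R)); last first.
      by rewrite egammaD1// egamma1 mule1 ltry.
    rewrite /egamma -ge0_integralD//; last 4 first.
    - by move=> s _; rewrite lee_fin gamma_fun_ge0.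
    - exact: measurable_egamma_fun.
    - by move=> s _; rewrite lee_fin gamma_fun_ge0.
    - exact: measurable_egamma_fun.
    apply: ge0_le_integral => //.
    - by move=> s _; rewrite lee_fin gamma_fun_ge0.
    - exact: measurable_egamma_fun.
    - by apply: emeasurable_funD; exact: measurable_egamma_fun.
    - move=> s /=; rewrite in_itv/= andbT => s0; rewrite -EFinD lee_fin /gamma_fun.
      rewrite !addrK subrr powRr0 -mulrDl ler_wpM2r ?expR_ge0// powRr1 ?(ltW s0)//.
      have [s1|s1] := leP s 1%R.
        rewrite (@le_trans _ _ 1%R)// ?lerDl ?(ltW s0)//.
        by rewrite -(powRr0 s); apply: ger_powR; rewrite ?s0//= ltW.
      rewrite (@le_trans _ _ s)// ?lerDr//.
      by rewrite -[leRHS](powRr1 (ltW s0)); apply: ler_powR => //; exact: ltW.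
  rewrite egammaD1//; have := egamma_gt0 y0; case: (egamma y) => // [r|] _.
    by move=> _; exact: ltry.
  by rewrite gt0_muley ?lte_fin// ltxx.
have shift n : forall y : R, (0 < y <= n.+1%:R)%R -> egamma y < +oo.
  elim: n => [y yn|n IH y /andP[y0 yn]]; first exact: le1.
  have [y1|y1] := leP y 1%R; first by apply: le1; rewrite y0.
  have -> : y = (y - 1 + 1)%R by rewrite subrK.
  have ym : (0 < y - 1 <= n.+1%:R)%R.
    by rewrite subr_gt0 y1 lerBlDr natr1.
  rewrite egammaD1; last by case/andP: ym.
  have := IH _ ym; have := egamma_ge0 (y - 1)%R.
  by case: (egamma (y - 1)%R) => // r _ _; rewrite -EFinM ltry.
by move=> x0; apply: (shift (Num.truncn x)); rewrite x0 ltW// truncnS_gt.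
Qed.

Lemma Gamma_egamma (x : R) : (0 < x)%R -> (Gamma x)%:E = egamma x.
Proof.
move=> x0; rewrite /Gamma /gamma_shift x0 big_geq// invr1 mulr1 addr0.
rewrite /gamma_integral /Rintegral fineK// ge0_fin_numE ?egamma_ge0//.
exact: egamma_fin.
Qed.

Local Close Scope ereal_scope.

Lemma Gamma_gt0 (x : R) : 0 < x -> 0 < Gamma x.
Proof. by move=> x0; rewrite -lte_fin Gamma_egamma// egamma_gt0. Qed.

Lemma GammaD1 (x : R) : 0 < x -> Gamma (x + 1) = x * Gamma x.
Proof.
move=> x0; have e1 := Gamma_egamma x0.
have e2 := Gamma_egamma (addr_gt0 x0 ltr01).
by have := egammaD1 x0; rewrite -e1 -e2 -EFinM => -[].
Qed.

Lemma Gamma1 : Gamma (1 : R) = 1.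
Proof. by have := Gamma_egamma ltr01; rewrite egamma1 => -[]. Qed.

(** On this interval [gamma_shift x] is 1, so the equation is the defining extension itself. It
    serves [a = H - 1/2] for [H < 1/2]. *)
Lemma GammaD1_neg (x : R) : - 1 < x < 0 -> Gamma (x + 1) = x * Gamma x.
Proof.
move=> /andP[x1 x0]; rewrite {2}/Gamma /gamma_shift ltNge (ltW x0)/=.
have -> : Num.truncn (- x) = 0%N.
  by apply: truncn_def; rewrite oppr_ge0 (ltW x0) ltrNl.
rewrite big_nat1 addr0 mulrCA divff ?lt_eqF// mulr1.
have x10 : 0 < x + 1 by rewrite -ltrBlDr sub0r.
by rewrite /Gamma /gamma_shift x10 big_geq// invr1 mulr1 addr0.
Qed.

Lemma hcoef0 (a : R) : - 1 < a -> a != 0 -> hcoef a 0 = 1.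
Proof.
move=> a1 a0; rewrite /hcoef !add0r Gamma1 mulr1 divff//.
have [agt0|ale0] := ltP 0 a; first by rewrite gt_eqF// Gamma_gt0.
have alt0 : a < 0 by rewrite lt_neqAle a0.
apply/eqP => G0; have := @GammaD1_neg a; rewrite a1 alt0 G0 mulr0 => /(_ isT).
by apply/eqP; rewrite gt_eqF// Gamma_gt0// -ltrBlDr sub0r.
Qed.

(** The factor [p] stands for [Gamma a]. If it is 0, its inverse is 0 by convention and both sides
    vanish. *)
Let frac_cancel (p q u v m : R) : v != 0 -> m != 0 ->
  m * (q * u / (p * (m * v))) = q * (u / (p * v)).
Proof.
move=> v0 m0; have [->|p0] := eqVneq p 0; first by rewrite !mul0r invr0 !mulr0.
by field; rewrite p0 v0 m0.
Qed.

Lemma hcoefS (a : R) n : - 1 < a -> a != 0 ->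
  n.+1%:R * hcoef a n.+1 = (n%:R + a) * hcoef a n.
Proof.
move=> a1 a0; rewrite /hcoef.
have -> : n.+1%:R + a = n%:R + a + 1 by rewrite -natr1 addrAC.
have -> : Gamma (n%:R + a + 1) = (n%:R + a) * Gamma (n%:R + a).
  case: n => [|n].
    rewrite !add0r; have [agt0|ale0] := ltP 0 a; first exact: GammaD1.
    by apply: GammaD1_neg; rewrite a1 lt_neqAle a0.
  apply: GammaD1; have : 1 <= n.+1%:R :> R by rewrite ler1n.
  by lra.
have Gn0 : Gamma (n.+1%:R : R) != 0 by rewrite gt_eqF// Gamma_gt0.
have m0 : n.+1%:R != 0 :> R by rewrite pnatr_eq0.
rewrite (@GammaD1 n.+1%:R)// natr1.
exact: frac_cancel.
Qed.

End gamma_function.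

(** * Integrating out one noise variable *)

Section resampling.
Context {d : measure_display} {T : measurableType d} {R : realType}.
Context (gamma : probability (measurableTypeR R) R).
Implicit Types (P : probability T R) (W : nat -> {mfun T >-> R}).
Notation RR := (measurableTypeR R).

(** A family closed under intersection, made of events on finitely many noises other than [W j]. *)
Definition cylinders W (j : nat) : set (set T) :=
  [set B | exists J (A : nat -> set RR), [/\ uniq J, j \notin J,
    (forall i, measurable (A i)) &
    B = [set w | forall i, i \in J -> A i (W i w)]]].

(* T with the sigma-algebra generated by the W i for i <> j. *)
Definition other_noise W j : measurableType (cylinders W j).-sigma :=
  g_sigma_algebraType (cylinders W j).

Lemma measurable_other_noise W i j : i != j ->
  measurable_fun setT (W i : other_noise W j -> RR).
Proof.
move=> ij _ B mB; rewrite setTI; apply: sub_sigma_algebra.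
exists [:: i], (fun=> B); split => //; first by rewrite inE eq_sym.
apply/seteqP; split => w /= h; first by move=> k; rewrite inE => /eqP ->.
by apply: h; rewrite inE.
Qed.

Lemma cylinders_measurable W j : cylinders W j `<=` measurable.
Proof.
move=> _ [J [A [_ _ mA ->]]].
rewrite (_ : [set w | _] =
    \bigcap_i (if i \in J then W i @^-1` A i else setT)).
  apply: bigcap_measurable => // i _; case: ifP => // _.
  rewrite -[X in measurable X]setTI.
  by apply: (measurable_funP (W i)); [exact: measurableT|exact: mA].
apply/seteqP; split => w /= h i; first by case: ifP => [iJ _|//]; exact: h.
by move=> iJ; have := h i I; rewrite iJ.
Qed.

Lemma other_noise_measurable W j (B : set (other_noise W j)) :
  measurable B -> d.-measurable (B : set T).
Proof.
by apply: smallest_sub; [exact: sigma_algebra_measurable|exact: cylinders_measurable].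
Qed.

Lemma measurable_id_other_noise W j :
  measurable_fun setT (idfun : T -> other_noise W j).
Proof. by move=> _ B mB; rewrite setTI; exact: (other_noise_measurable mB). Qed.

(* All that is used about P: it survives conditioning on the past up to t. *)
Definition fresh_after P W (t : nat) := forall j, (t < j)%N ->
  forall (B : set (other_noise W j)) (C : set RR), measurable B ->
  measurable C -> P ((B : set T) `&` W j @^-1` C) = (P (B : set T) * gamma C)%E.

(** Freshness says that the pair [(w, W j w)] has a product law: [P] restricted to the other noises,
    times [gamma]. The claim is Tonelli's theorem for this product. *)
Lemma integral_fresh P W t j (F : other_noise W j * RR -> \bar R) :
  fresh_after P W t -> (t < j)%N ->
  measurable_fun setT F -> (forall p, 0 <= F p)%E ->
  (\int[P]_w F (w, W j w) = \int[P]_w \int[gamma]_x F (w, x))%E.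
Proof.
move=> PW tj mF F0.
have mid : measurable_fun setT (fun w : T => (w, W j w) : other_noise W j * RR).
  apply: measurable_fun_pair; first exact: measurable_id_other_noise.
  exact: (measurable_funP (W j)).
pose m' := image_measure P mid.
pose idm : {mfun T >-> other_noise W j} := HB.pack (idfun : T -> other_noise W j)
  (isMeasurableFun.Build _ _ _ _ _ (@measurable_id_other_noise W j)).
pose m1P : probability (other_noise W j) R := distribution P idm.
transitivity (\int[m']_p F p)%E.
  by rewrite ge0_integral_pushforward//.
transitivity (\int[m1P \x gamma]_p F p)%E.
  apply: eq_measure_integral => A mA _; apply/esym.
  apply: (product_measure_unique (m' := m')) => // B C mB mC.
  by rewrite -[RHS](PW j tj).
rewrite fubini_tonelli1//.
rewrite ge0_integral_pushforward//.
- exact: (measurable_fun_fubini_tonelli_F F mF F0).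
- by move=> w _; exact: integral_ge0.
Qed.

(** For fixed [C] both sides are finite measures in [B], called [m1] and [m2]. They agree on
    cylinders by mutual independence, hence on the sigma-algebra which these generate. *)
Lemma independent_fresh P W t : mutually_independent P W ->
  (forall n A, measurable A -> distribution P (W n) A = gamma A) ->
  fresh_after P W t.
Proof.
move=> indep law j _ B C mB mC.
have mWC : measurable (W j @^-1` C).
  by rewrite -[X in measurable X]setTI; exact: (measurable_funP (W j)).
pose m1 := image_measure (mrestr P mWC) (@measurable_id_other_noise W j).
have g0 : (0 <= fine (gamma C))%R by rewrite fine_ge0.
pose m2 := mscale (NngNum g0) (image_measure P (@measurable_id_other_noise W j)).
have -> : P ((B : set T) `&` W j @^-1` C) = m1 B by [].
have m2E (X : set T) : (m2 X = P X * gamma C)%E.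
  by rewrite /m2 /mscale/= fineK ?fin_num_measure// muleC.
rewrite -m2E.
apply: (@g_sigma_algebra_measure_unique _ _ (other_noise W j) (cylinders W j) _ (fun=> setT)) => //.
- by move=> A; exact: sub_sigma_algebra.
- by move=> _; exists [::], (fun=> setT); split => //; apply/seteqP; split.
- by rewrite bigcup_const.
- move=> _ _ [J1 [A1 [u1 j1 mA1 ->]]] [J2 [A2 [u2 j2 mA2 ->]]].
  exists (undup (J1 ++ J2)), (fun i => (if i \in J1 then A1 i else setT) `&`
    (if i \in J2 then A2 i else setT)); split.
  + exact: undup_uniq.
  + by rewrite mem_undup mem_cat negb_or j1.
  + by move=> i; apply: measurableI; case: ifP.
  + apply/seteqP; split => w /=.
      by move=> [h1 h2] i _; split; case: ifP => // iJ; [exact: h1|exact: h2].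
    move=> h; split => i iJ.
      by have := h i; rewrite mem_undup mem_cat iJ/= => /(_ isT)[].
    by have := h i; rewrite mem_undup mem_cat iJ orbT => /(_ isT)[].
- move=> _ [J [A [uJ jJ mA ->]]].
  rewrite [RHS]m2E muleC.
  (* Putting [C] at index [j] makes the intersection a cylinder event over [j :: J], to which
     independence applies. *)
  pose A' i := if i == j then C else A i.
  have eA i : i \in J -> A' i = A i.
    by rewrite /A'; case: eqP => [->|//]; rewrite (negbTE jJ).
  have H1 := indep J A uJ mA.
  have H2 := indep (j :: J) A'.
  transitivity (P [set w | forall i, i \in j :: J -> A' i (W i w)]).
    congr (P _); apply/seteqP; split => w /=.
      move=> [h1 h2] i; rewrite inE => /orP[/eqP ->|iJ].
        by rewrite /A' eqxx.
      by rewrite eA//; exact: h1.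
    move=> h; split => [i iJ|].
      by rewrite -eA//; apply: h; rewrite inE iJ orbT.
    by have := h j; rewrite inE eqxx /A' eqxx => /(_ isT).
  rewrite H2; last 2 first.
  - by rewrite /= jJ.
  - by move=> i; rewrite /A'; case: ifP.
  rewrite big_cons; congr (_ * _)%E.
    by rewrite /A' eqxx -[LHS]/(distribution P (W j) C) law.
  rewrite H1; apply: eq_big_seq => i iJ; by rewrite eA.
- have h : (P (setT `&` W j @^-1` C) <= 1)%E by apply: probability_le1; rewrite setTI.
  by move=> _; exact: le_lt_trans h (ltry _).
Qed.

End resampling.

(** * Linear combinations of the noise *)

Section linear_combinations.
Context {d : measure_display} {T : measurableType d} {R : realType}.
Notation RR := (measurableTypeR R).
Notation mu := (@lebesgue_measure R).
Context (gamma : probability RR R)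
  (gammaE : forall A, measurable A -> gamma A = normal_prob (0%R : R) 1%R A).
Context (P : probability T R) (W : nat -> {mfun T >-> R}) (t : nat).
Hypothesis Wfresh : fresh_after gamma P W t.
Implicit Types (u v : nat -> R) (x y : R).

Definition lincomb (N : nat) u x (w : T) : R :=
  x + \sum_(0 <= i < N) u i * W i w.

Definition zero_at (j : nat) u (i : nat) : R := if i == j then 0 else u i.

Definition zero_on (J : seq nat) u (i : nat) : R := if i \in J then 0 else u i.

Lemma zero_at_id j u i : i != j -> zero_at j u i = u i.
Proof. by rewrite /zero_at => /negbTE ->. Qed.

Lemma lincomb_zero_at N j u x w : (j < N)%N ->
  lincomb N u x w = lincomb N (zero_at j u) x w + u j * W j w.
Proof.
move=> jN; rewrite /lincomb -addrA; congr (_ + _).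
have jin : j \in index_iota 0 N by rewrite mem_index_iota.
rewrite (bigD1_seq j)//= ?iota_uniq// [in RHS](bigD1_seq j)//= ?iota_uniq//.
rewrite {1}/zero_at eqxx mul0r add0r addrC; congr (_ + _).
by apply: eq_bigr => i ij; rewrite zero_at_id.
Qed.

Lemma eq_lincomb N u v x w : u =1 v -> lincomb N u x w = lincomb N v x w.
Proof. by move=> uv; congr (_ + _); apply: eq_bigr => i _; rewrite uv. Qed.

Lemma measurable_lincomb N u x : measurable_fun setT (lincomb N u x : T -> RR).
Proof.
apply: measurable_funD; first exact: measurable_cst.
apply: measurable_sum => i; apply: measurable_funM; first exact: measurable_cst.
exact: (measurable_funP (W i)).
Qed.

Lemma measurable_lincomb_other N j u x : u j = 0 ->
  measurable_fun setT (lincomb N u x : other_noise W j -> RR).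
Proof.
move=> uj; apply: measurable_funD; first exact: measurable_cst.
apply: measurable_sum => i; have [->|ij] := eqVneq i j.
  rewrite uj; under eq_fun do rewrite mul0r; exact: measurable_cst.
by apply: measurable_funM; [exact: measurable_cst|exact: measurable_other_noise].
Qed.

Local Open Scope ereal_scope.

Lemma integral_lincomb_resample1 (N j : nat) u x (f : RR -> \bar R) :
  (t < j < N)%N -> measurable_fun setT f -> (forall x, 0 <= f x) ->
  \int[P]_w f (lincomb N u x w) =
  \int[P]_w \int[gamma]_y f (lincomb N (zero_at j u) x w + u j * y)%R.
Proof.
move=> /andP[tj jN] mf f0.
under eq_integral do rewrite (lincomb_zero_at _ _ _ jN).
pose F (p : other_noise W j * RR) := f (lincomb N (zero_at j u) x p.1 + u j * p.2)%R.
apply: (integral_fresh (F := F) Wfresh tj); last by move=> p; exact: f0.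
apply: (measurableT_comp mf); apply: measurable_funD.
  apply: (measurableT_comp _ measurable_fst).
  by apply: measurable_lincomb_other; rewrite /zero_at eqxx.
by apply: measurable_funM; [exact: measurable_cst|exact: measurable_snd].
Qed.

(** Induction on [J]: one noise is integrated out into a new integrand [f1], the induction
    hypothesis treats the others, and [stdnormal_convolution] merges the two Gaussian variables,
    adding their variances. *)
Lemma integral_lincomb_resample (N : nat) (J : seq nat) u x (f : RR -> \bar R) :
  uniq J -> (forall j, j \in J -> (t < j < N)%N) ->
  (forall j, j \in J -> 0 <= u j)%R ->
  measurable_fun setT f -> (forall x, 0 <= f x) ->
  \int[P]_w f (lincomb N u x w) =
  \int[P]_w \int[gamma]_y f (lincomb N (zero_on J u) x w +
     Num.sqrt (\sum_(j <- J) u j ^+ 2) * y)%R.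
Proof.
elim: J u f => [|j J IH] u f.
  move=> _ _ _ _ _; apply: eq_integral => w _; rewrite big_nil sqrtr0.
  under eq_integral do rewrite mul0r addr0.
  by rewrite integral_probability_cst.
move=> /= /andP[jJ uJ] JN u0 mf f0.
pose f1 (z : RR) : \bar R := \int[gamma]_y f (z + u j * y)%R.
have f10 z : 0 <= f1 z by exact: integral_ge0.
have mf1 : measurable_fun (setT : set RR) f1.
  apply: (measurable_fun_fubini_tonelli_F (m2 := gamma)
    (fun p : RR * RR => f (p.1 + u j * p.2)%R)); last by move=> p; exact: f0.
  apply: (measurableT_comp mf); apply: measurable_funD; first exact: measurable_fst.
  by apply: measurable_funM; [exact: measurable_cst|exact: measurable_snd].
transitivity (\int[P]_w f1 (lincomb N (zero_at j u) x w)).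
  by apply: integral_lincomb_resample1 => //; apply: JN; rewrite inE eqxx.
have zJ i : i \in J -> zero_at j u i = u i.
  by move=> iJ; apply: zero_at_id; apply: contraNneq jJ => <-.
have JN' i : i \in J -> (t < i < N)%N.
  by move=> iJ; apply: JN; rewrite inE iJ orbT.
have zu0 i : i \in J -> (0 <= zero_at j u i)%R.
  by move=> iJ; rewrite zJ//; apply: u0; rewrite inE iJ orbT.
apply: (etrans (IH (zero_at j u) f1 uJ JN' zu0 mf1 f10)).
apply: eq_integral => w _.
rewrite big_cons addrC.
have -> : (\sum_(i <- J) zero_at j u i ^+ 2 = \sum_(i <- J) u i ^+ 2)%R.
  by apply: eq_big_seq => i iJ; rewrite zJ.
set V := (\sum_(i <- J) u i ^+ 2)%R.
have V0 : (0 <= V)%R by apply: sumr_ge0 => i _; exact: sqr_ge0.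
have eL : lincomb N (zero_on J (zero_at j u)) x w = lincomb N (zero_on (j :: J) u) x w.
  apply: eq_lincomb => i; rewrite /zero_on /zero_at inE.
  by case: (i == j) => //=; case: (i \in J).
rewrite eL; have := stdnormal_convolution gammaE (lincomb N (zero_on (j :: J) u) x w)
  (Num.sqrt V) mf f0 (u0 j (mem_head _ _)).
by rewrite sqr_sqrtr.
Qed.

Lemma integral_lincomb_periodic1_le (N : nat) (J : seq nat) u x (f : RR -> \bar R) :
  uniq J -> (forall j, j \in J -> (t < j < N)%N) ->
  (forall j, j \in J -> 0 <= u j)%R ->
  (0 < \sum_(j <- J) u j ^+ 2)%R ->
  measurable_fun setT f -> (forall x, 0 <= f x) -> periodic1 f ->
  \int[P]_w f (lincomb N u x w) <=
  (1 + 2 * normal_peak (Num.sqrt (\sum_(j <- J) u j ^+ 2)))%:E *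
  \int[mu]_(x in `[0%R, 1%R]) f x.
Proof.
move=> uJ JN u0 V0 mf f0 pf; rewrite (integral_lincomb_resample x uJ JN u0 mf f0).
set s := Num.sqrt _; set B := _ * _.
have s0 : s != 0%R by rewrite gt_eqF// sqrtr_gt0.
rewrite -[leRHS](integral_probability_cst P); apply: ge0_le_integral => //.
- by move=> w _; exact: integral_ge0.
- have := measurable_fun_fubini_tonelli_F (m2 := gamma)
    (fun p : RR * RR => f (p.1 + s * p.2)%R).
  move=> H; apply: (measurableT_comp (H _ _) (measurable_lincomb N (zero_on J u) x)).
    apply: (measurableT_comp mf); apply: measurable_funD; first exact: measurable_fst.
    by apply: measurable_funM; [exact: measurable_cst|exact: measurable_snd].
  by move=> p; exact: f0.
by move=> w _; exact: integral_stdnormal_periodic1_le.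
Qed.

(** Noise [m] is integrated out first, and the first combination is unaffected since [u m = 0]. The
    result [K] depends on two combinations, in both of which noise [j] is then integrated out. *)
Lemma integral_lincomb2_resample (N j m : nat) u v x y (F : RR * RR -> \bar R) :
  (t < j < N)%N -> (t < m < N)%N -> j != m -> u m = 0%R ->
  measurable_fun setT F -> (forall p, 0 <= F p) ->
  \int[P]_w F (lincomb N u x w, lincomb N v y w) =
  \int[P]_w \int[gamma]_a \int[gamma]_b
    F (lincomb N (zero_at j u) x w + u j * a,
       lincomb N (zero_at j (zero_at m v)) y w + v j * a + v m * b)%R.
Proof.
move=> /andP[tj jN] /andP[tm mN] jm um mF F0.
pose F1 (p : other_noise W m * RR) :=
  F (lincomb N u x p.1, lincomb N (zero_at m v) y p.1 + v m * p.2)%R.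
transitivity (\int[P]_w F1 (w, W m w)).
  by apply: eq_integral => w _; rewrite (lincomb_zero_at v _ _ mN).
rewrite (integral_fresh (F := F1) Wfresh tm); last 2 first.
- apply: (measurableT_comp mF); apply: measurable_fun_pair.
    apply: (measurableT_comp _ measurable_fst).
    exact: measurable_lincomb_other.
  apply: measurable_funD.
    apply: (measurableT_comp _ measurable_fst).
    by apply: measurable_lincomb_other; rewrite /zero_at eqxx.
  by apply: measurable_funM; [exact: measurable_cst|exact: measurable_snd].
- by move=> p; exact: F0.
pose K (q : RR * RR) : \bar R := \int[gamma]_b F (q.1, q.2 + v m * b)%R.
have mK : measurable_fun (setT : set (RR * RR)) K.
  apply: (measurable_fun_fubini_tonelli_F (m2 := gamma)
    (fun p : (RR * RR) * RR => F (p.1.1, p.1.2 + v m * p.2)%R)); last by move=> p; exact: F0.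
  apply: (measurableT_comp mF); apply: measurable_fun_pair.
    exact: (measurableT_comp measurable_fst measurable_fst).
  apply: measurable_funD; first exact: (measurableT_comp measurable_snd measurable_fst).
  by apply: measurable_funM; [exact: measurable_cst|exact: measurable_snd].
have K0 q : 0 <= K q by exact: integral_ge0.
pose F2 (p : other_noise W j * RR) := K (lincomb N (zero_at j u) x p.1 + u j * p.2,
  lincomb N (zero_at j (zero_at m v)) y p.1 + v j * p.2)%R.
transitivity (\int[P]_w F2 (w, W j w)).
  apply: eq_integral => w _; rewrite /F1/= /F2/=.
  rewrite (lincomb_zero_at u _ _ jN) (lincomb_zero_at (zero_at m v) _ _ jN).
  by rewrite (zero_at_id v jm).
rewrite (integral_fresh (F := F2) Wfresh tj)//; last by move=> p; exact: K0.
apply: (measurableT_comp mK); apply: measurable_fun_pair; apply: measurable_funD.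
- apply: (measurableT_comp _ measurable_fst).
  by apply: measurable_lincomb_other; rewrite /zero_at eqxx.
- by apply: measurable_funM; [exact: measurable_cst|exact: measurable_snd].
- apply: (measurableT_comp _ measurable_fst).
  by apply: measurable_lincomb_other; rewrite /zero_at eqxx.
- by apply: measurable_funM; [exact: measurable_cst|exact: measurable_snd].
Qed.

(** Noises [j] and [m] average [F] over its first argument, which leaves a function [psi] of the
    second one; the noises in [J] then average [psi]. Since the intermediate bound is again an
    expectation with all noises in place, [J] may contain [j]. *)
Lemma integral_lincomb2_periodic1_le (N j m : nat) (J : seq nat) u v x y
    (F : RR * RR -> \bar R) :
  (t < j < N)%N -> (t < m < N)%N -> j != m ->
  u m = 0%R -> u j != 0%R -> v j != 0%R -> v m != 0%R ->
  uniq J -> (forall j, j \in J -> (t < j < N)%N) ->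
  (forall j, j \in J -> 0 <= v j)%R -> (0 < \sum_(j <- J) v j ^+ 2)%R ->
  measurable_fun setT F -> (forall p, 0 <= F p) ->
  (forall e, periodic1 (fun x => F (x, e))) ->
  (forall x, periodic1 (fun e => F (x, e))) ->
  \int[P]_w F (lincomb N u x w, lincomb N v y w) <=
  ((1 + 2 * normal_peak (u j * v m / Num.sqrt (v j ^+ 2 + v m ^+ 2))) *
   (1 + 2 * normal_peak (Num.sqrt (\sum_(j <- J) v j ^+ 2))))%:E *
  \int[mu]_(e in `[0%R, 1%R]) \int[mu]_(x in `[0%R, 1%R]) F (x, e).
Proof.
move=> tjN tmN jm um uj vj vm uJ JN v0 V0 mF F0 pF1 pF2.
set A := (1 + 2 * normal_peak (_ / _))%R; set B := (1 + 2 * normal_peak _)%R.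
have A0 : (0 <= A)%R by rewrite addr_ge0// mulr_ge0// normal_peak_ge0.
pose psi (e : RR) : \bar R := \int[mu]_(x in `[0%R, 1%R]) F (x, e).
have mpsi : measurable_fun (setT : set RR) psi by exact: measurable_integral_fst01.
have psi0 e : 0 <= psi e by exact: integral_ge0.
have ppsi : periodic1 psi.
  by move=> e; apply: eq_integral => z _; exact: (pF2 z).
apply: (@le_trans _ _ (A%:E * \int[P]_w psi (lincomb N v y w))); last first.
  rewrite EFinM -muleA lee_wpmul2l ?lee_fin//.
  exact: integral_lincomb_periodic1_le.
rewrite (integral_lincomb2_resample v x y tjN tmN jm um mF F0).
(* The same two noises are resampled on the right side, so that the two sides compare for each
   [w]. *)
rewrite (integral_lincomb2_resample (F := fun p => psi p.2) v x y tjN tmN jm um)//; last first.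
  exact: (measurableT_comp mpsi measurable_snd).
have mlin (K : RR * RR -> \bar R) : measurable_fun setT K -> (forall p, 0 <= K p) ->
    measurable_fun setT (fun w : T => \int[gamma]_a \int[gamma]_b
      K (lincomb N (zero_at j u) x w + u j * a,
       lincomb N (zero_at j (zero_at m v)) y w + v j * a + v m * b)%R).
  move=> mK K0.
  pose K1 (q : (RR * RR) * RR) : \bar R := \int[gamma]_b
    K (q.1.1 + u j * q.2, q.1.2 + v j * q.2 + v m * b)%R.
  have mK1 : measurable_fun (setT : set ((RR * RR) * RR)) K1.
    apply: (measurable_fun_fubini_tonelli_F (m2 := gamma)
      (fun p : ((RR * RR) * RR) * RR => K (p.1.1.1 + u j * p.1.2,
        p.1.1.2 + v j * p.1.2 + v m * p.2)%R));
      last by move=> p; exact: K0.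
    have m1 := @measurable_fst _ _ ((RR * RR) * RR)%type RR.
    have m1' := measurableT_comp (@measurable_fst _ _ (RR * RR)%type RR) m1.
    have m11 := measurableT_comp (@measurable_fst _ _ RR RR) m1'.
    have m12 := measurableT_comp (@measurable_snd _ _ RR RR) m1'.
    have m2 := measurableT_comp (@measurable_snd _ _ (RR * RR)%type RR) m1.
    apply: (measurableT_comp mK); apply: measurable_fun_pair.
      apply: measurable_funD; first exact: m11.
      by apply: measurable_funM; [exact: measurable_cst|exact: m2].
    apply: measurable_funD.
      apply: measurable_funD; first exact: m12.
      by apply: measurable_funM; [exact: measurable_cst|exact: m2].
    by apply: measurable_funM; [exact: measurable_cst|exact: measurable_snd].
  have K10 q : 0 <= K1 q by exact: integral_ge0.
  have mF1 := measurable_fun_fubini_tonelli_F (m2 := gamma) K1 mK1 K10.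
  have mp : measurable_fun (setT : set T) (fun w => (lincomb N (zero_at j u) x w,
      lincomb N (zero_at j (zero_at m v)) y w) : RR * RR).
    by apply: measurable_fun_pair; exact: measurable_lincomb.
  exact (measurableT_comp mF1 mp).
rewrite -ge0_integralZl//; last 2 first.
- exact: (mlin (fun p => psi p.2) (measurableT_comp mpsi measurable_snd)).
- by move=> w _; apply: integral_ge0 => a _; exact: integral_ge0.
apply: ge0_le_integral => //.
- by move=> w _; apply: integral_ge0 => a _; exact: integral_ge0.
- exact: mlin.
- apply: emeasurable_funM; first exact: measurable_cst.
  exact: (mlin (fun p => psi p.2) (measurableT_comp mpsi measurable_snd)).
move=> w _; exact: stdnormal2_periodic1_le.
Qed.

End linear_combinations.

(** * Joint equidistribution of the modulator states *)

(** In generating functions, summation is multiplication by [(1 - z)^-1], which can be absorbed into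
    the kernel [u]. *)
Lemma sum_convolution_psum {R : realType} (u z : nat -> R) n :
  \sum_(0 <= i < n.+1) \sum_(0 <= j < i.+1) u (i - j)%N * z j =
  \sum_(0 <= j < n.+1) psum u (n - j)%N * z j.
Proof.
elim: n => [|n IH]; first by rewrite !big_nat1 subnn psum0.
rewrite big_nat_recr//= IH [X in _ + X]big_nat_recr//= addrA -big_split/=.
rewrite [RHS]big_nat_recr//= subnn psum0; congr (_ + _).
apply: eq_big_nat => j /andP[_ jn].
by rewrite -mulrDl subSn// psumS.
Qed.

Lemma normal_peak_inv {R : realType} (s : R) : 0 < s ->
  normal_peak s = normal_peak 1 / s.
Proof.
move=> s0; rewrite (@normal_peak_scale _ s) ?gt_eqF// gtr0_norm//.
by rewrite mulrAC divff ?mul1r// gt_eqF.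
Qed.

Lemma peak_frac {R : realType} (p q r x : R) : q != 0 -> r != 0 -> x != 0 ->
  p / (q / x / x / (r / x)) = p * x * (r / q).
Proof. by move=> q0 r0 x0; field; rewrite q0 r0 x0. Qed.

Lemma peak_frac1 {R : realType} (p s x : R) : s != 0 -> x != 0 ->
  p / (s / x) = p * x / s.
Proof. by move=> s0 x0; field; rewrite s0 x0. Qed.

Section equidistribution.
Context {d : measure_display} {T : measurableType d} {R : realType}.
Notation RR := (measurableTypeR R).
Notation mu := (@lebesgue_measure R).
Context (gamma : probability RR R)
  (gammaE : forall A, measurable A -> gamma A = normal_prob (0%R : R) 1%R A).
Context (P : probability T R) (W : nat -> {mfun T >-> R}) (t : nat).
Hypothesis Wfresh : fresh_after gamma P W t.
Context (a : R) (a_itv : - 2^-1 < a < 2^-1) (eta : nat -> R).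
Hypothesis eta0 : eta 0%N = 1.
Hypothesis etaS : forall n, n.+1%:R * eta n.+1 = (n%:R + a) * eta n.
Context (Delta : R) (Delta_gt0 : 0 < Delta).

Let c := psum (psum eta).
Let c_gt0 m : 0 < c m := psum2_gt0 a_itv eta0 etaS m.
Let g_gt0 k l : (0 < k)%N -> 0 < gap eta k l := gap_gt0 a_itv eta0 etaS l.

(** Extended by 0 beyond [n], so that the states at two times are combinations over a common range
    of indices. *)
Definition sd_coef (n j : nat) : R :=
  if (j <= n)%N then psum (psum eta) (n - j)%N / Delta else 0.

Definition sd_state (n : nat) : T -> R :=
  lincomb W n.+1 (sd_coef n) (n.+1%:R / 2).

Lemma sd_state_pad n N w : (n < N)%N ->
  sd_state n w = lincomb W N (sd_coef n) (n.+1%:R / 2) w.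
Proof.
move=> nN; rewrite /sd_state /lincomb; congr (_ + _).
rewrite [RHS](@big_cat_nat _ _ _ n.+1)//= [X in _ = _ + X]big_nat_cond.
rewrite [X in _ = _ + X]big1 ?addr0// => i /andP[/andP[ni _] _].
by rewrite /sd_coef leqNgt ni mul0r.
Qed.

Lemma sd_state_gap n k w : sd_state (n + k) w - sd_state n w =
  lincomb W (n + k).+1 (fun j => sd_coef (n + k) j - sd_coef n j) (k%:R / 2) w.
Proof.
rewrite (@sd_state_pad n (n + k).+1) ?ltnS ?leq_addr// /sd_state /lincomb.
rewrite opprD addrACA -sumrB; congr (_ + _).
  by rewrite -addSn natrD; field.
by apply: eq_bigr => i _; rewrite mulrBl.
Qed.

(** The constant of [integral_lincomb2_periodic1_le] for [j = t + 1], [m = n + k] and [J] from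
    [t + 1] to [n], with each peak written as [normal_peak 1] over the deviation. *)
Definition sd_rate (k n : nat) : R :=
  (1 + 2 * (normal_peak 1 * Delta * (Num.sqrt (gap eta k (n - t.+1) ^+ 2 + 1) /
     psum (psum eta) (n - t.+1)%N))) *
  (1 + 2 * (normal_peak 1 * Delta *
     (Num.sqrt (\sum_(0 <= l < n - t) gap eta k l ^+ 2))^-1)).

(** Both deviations tend to infinity, by [gap_ratio_cvg0] and [gap_square_cvgy]; the shifts of the
    index by [t] and [t + 1] do not affect the limit. *)
Lemma sd_rate_cvg1 k : (0 < k)%N -> sd_rate k n @[n --> \oo] --> (1 : R).
Proof.
move=> k0; have -> : 1 = (1 + 2 * (normal_peak 1 * Delta * 0)) *
    (1 + 2 * (normal_peak 1 * Delta * 0)) :> R by rewrite !mulr0 addr0 mulr1.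
have center (N : nat) (u : nat -> R) (l : R) :
    u n @[n --> \oo] --> l -> u (n - N)%N @[n --> \oo] --> l.
  by move=> ul; apply: cvg_comp ul; exact: cvg_subnr.
apply: cvgM; apply: cvgD; [exact: cvg_cst| |exact: cvg_cst|].
  do 2 apply: cvgMr.
  exact: (center t.+1 _ _ (gap_ratio_cvg0 a_itv eta0 etaS k)).
do 2 apply: cvgMr.
apply: (center t (fun n => (Num.sqrt (\sum_(0 <= l < n) gap eta k l ^+ 2))^-1)).
have V := gap_square_cvgy a_itv eta0 etaS k0.
have V0 n : 0 <= \sum_(0 <= l < n) gap eta k l ^+ 2.
  by apply: sumr_ge0 => i _; exact: sqr_ge0.
have Vinv : (\sum_(0 <= l < n) gap eta k l ^+ 2)^-1 @[n --> \oo] --> (0 : R).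
  apply/gtr0_cvgV0; last exact: V.
  by move/cvgryPgt : V => /(_ 0).
have := cvg_comp _ _ Vinv (@sqrt_continuous R 0); rewrite sqrtr0 => Vsqrt.
by under eq_fun do rewrite -sqrtrV//.
Qed.

Let gap_coef n k j : (j <= n)%N ->
  sd_coef (n + k) j - sd_coef n j = gap eta k (n - j) / Delta.
Proof.
move=> jn; rewrite /sd_coef jn (leq_trans jn) ?leq_addr// -mulrBl /gap.
by rewrite addnBAC.
Qed.

Let sum_gap_coef n k : (t < n)%N ->
  \sum_(j <- index_iota t.+1 n.+1) (sd_coef (n + k) j - sd_coef n j) ^+ 2 =
  (\sum_(0 <= l < n - t) gap eta k l ^+ 2) / Delta ^+ 2.
Proof.
move=> tn; rewrite big_nat_rev/= -[in LHS](add0n t.+1) big_addn subSS.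
rewrite mulr_suml; apply: eq_big_nat => i /andP[_ it].
rewrite gap_coef; last by lia.
rewrite expr_div_n; congr (gap eta k _ ^+ 2 / _); lia.
Qed.

Local Open Scope ereal_scope.

(** The noise [W (n + k)] is absent from the state at [n] and enters the increment with coefficient
    [Delta^-1]. The noise [W (t + 1)] is the earliest one free after [t], and has coefficient
    [c (n - t.+1) / Delta] in the state, which tends to infinity. *)
Lemma sd_state_expectation_le (k n : nat) (F : RR * RR -> \bar R) :
  (0 < k)%N -> (t < n)%N ->
  measurable_fun setT F -> (forall p, 0 <= F p) ->
  (forall e, periodic1 (fun x => F (x, e))) ->
  (forall x, periodic1 (fun e => F (x, e))) ->
  \int[P]_w F (sd_state n w, sd_state (n + k) w - sd_state n w)%R <=
  (sd_rate k n)%:E *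
  \int[mu]_(e in `[0%R, 1%R]) \int[mu]_(x in `[0%R, 1%R]) F (x, e).
Proof.
move=> k0 tn mF F0 pF1 pF2.
have c1 : (t < t.+1 < (n + k).+1)%N by rewrite leqnn/=; clear -tn; lia.
have c2 : (t < n + k < (n + k).+1)%N by rewrite leqnn andbT; clear -tn; lia.
have c3 : t.+1 != (n + k)%N by apply/eqP; clear -tn k0; lia.
have c4 j : j \in index_iota t.+1 n.+1 -> (t < j < (n + k).+1)%N.
  by rewrite mem_index_iota; clear; lia.
under eq_integral.
  move=> w _; rewrite (@sd_state_pad n (n + k).+1) ?ltnS ?leq_addr//.
  rewrite -(@sd_state_pad n (n + k).+1) ?ltnS ?leq_addr// sd_state_gap.
  rewrite (@sd_state_pad n (n + k).+1) ?ltnS ?leq_addr//; over.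
set u := sd_coef n; set v := (fun j => sd_coef (n + k) j - sd_coef n j)%R.
have D0 : (Delta != 0)%R by rewrite gt_eqF.
have uj : u t.+1 = (c (n - t.+1) / Delta)%R by rewrite /u /sd_coef tn.
have vj : v t.+1 = (gap eta k (n - t.+1) / Delta)%R by rewrite /v gap_coef.
have um : u (n + k)%N = 0%R.
  by rewrite /u /sd_coef leqNgt -{1}[n]addn0 ltn_add2l k0.
have vm : v (n + k)%N = (Delta^-1)%R.
  rewrite /v -/u um subr0 /sd_coef leqnn subnn psum0 psum0 eta0 mul1r//.
have sgt0 : (0 < \sum_(0 <= l < n - t) gap eta k l ^+ 2)%R.
  rewrite -(subnKC (_ : 0 < n - t)%N) ?subn_gt0// big_nat_recl//=.
  rewrite ltr_pwDl ?exprn_gt0 ?g_gt0//.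
  by apply: sumr_ge0 => i _; exact: sqr_ge0.
have := @integral_lincomb2_periodic1_le _ _ _ _ gammaE _ _ _ Wfresh (n + k).+1
  t.+1 (n + k)%N (index_iota t.+1 n.+1) u v (n.+1%:R / 2)%R (k%:R / 2)%R F.
rewrite [X in (0 < X)%R -> _](sum_gap_coef k tn).
move=> H; apply: (le_trans (H _ _ _ _ _ _ _ _ _ _ _ mF F0 pF1 pF2)).
- exact: c1.
- exact: c2.
- exact: c3.
- exact: um.
- by rewrite uj mulf_neq0 ?invr_eq0// gt_eqF.
- by rewrite vj mulf_neq0 ?invr_eq0// gt_eqF// g_gt0.
- by rewrite vm invr_eq0.
- exact: iota_uniq.
- exact: c4.
- move=> j; rewrite mem_index_iota => /andP[_ jn]; rewrite /v gap_coef//.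
  by rewrite divr_ge0 ?(ltW (g_gt0 _ k0))// ltW.
- by rewrite divr_gt0// exprn_gt0.
rewrite lee_wpmul2r//.
  by apply: integral_ge0 => e _; exact: integral_ge0.
rewrite lee_fin le_eqVlt; apply/orP; left; apply/eqP.
rewrite /sd_rate sum_gap_coef//.
set s := Num.sqrt (\sum_(0 <= l < n - t) _).
have s0 : (0 < s)%R by rewrite sqrtr_gt0.
have -> : Num.sqrt ((\sum_(0 <= l < n - t) gap eta k l ^+ 2) / Delta ^+ 2) = (s / Delta)%R.
  rewrite sqrtrM ?(ltW sgt0)// -exprVn sqrtr_sqr ger0_norm// invr_ge0 ltW//.
rewrite uj vj vm.
set r := Num.sqrt (gap _ _ _ ^+ 2 + 1).
have r0 : (0 < r)%R by rewrite sqrtr_gt0 ltr_wpDl ?sqr_ge0.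
have -> : (Num.sqrt ((gap eta k (n - t.+1) / Delta) ^+ 2 + Delta^-1 ^+ 2) = r / Delta)%R.
  have -> : ((gap eta k (n - t.+1) / Delta) ^+ 2 + Delta^-1 ^+ 2 =
      (gap eta k (n - t.+1) ^+ 2 + 1) * Delta^-1 ^+ 2)%R by ring.
  rewrite sqrtrM ?addr_ge0 ?sqr_ge0//.
  by rewrite sqrtr_sqr ger0_norm// invr_ge0 ltW.
rewrite -/(c (n - t.+1)); have c0 := c_gt0 (n - t.+1).
have pos : (0 < c (n - t.+1) / Delta / Delta / (r / Delta))%R by rewrite !divr_gt0.
rewrite (normal_peak_inv pos) (normal_peak_inv (divr_gt0 s0 Delta_gt0)).
have cn0 : c (n - t.+1) != 0%R by rewrite gt_eqF.
have rn0 : r != 0%R by rewrite gt_eqF.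
have sn0 : s != 0%R by rewrite gt_eqF.
by congr ((1 + 2 * _) * (1 + 2 * _))%R; [exact: peak_frac|exact: peak_frac1].
Qed.

Lemma integral_onem_probability d' (T' : measurableType d') (Q : probability T' R)
    (G : T' -> R) : measurable_fun setT G -> (forall x, 0 <= G x <= 1)%R ->
  \int[Q]_x (G x)%:E + \int[Q]_x (1 - G x)%:E = 1.
Proof.
move=> mG G01; rewrite -ge0_integralD//.
- under eq_integral do rewrite -EFinD addrCA subrr addr0.
  exact: integral_probability_cst.
- by move=> x _; rewrite lee_fin; have /andP[] := G01 x.
- exact/measurable_EFinP.
- by move=> x _; rewrite lee_fin subr_ge0; have /andP[] := G01 x.
- by apply/measurable_EFinP; exact: measurable_funB.
Qed.

Lemma integral_itv01E (f : RR -> \bar R) : measurable_fun setT f ->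
  (forall x, 0 <= f x) ->
  \int[mu]_(x in `[0%R, 1%R]) f x = \int[uniform_prob (@ltr01 R)]_x f x.
Proof.
by move=> mf f0; rewrite integral_uniform// subr0 invr1 mul1e.
Qed.

Lemma measurable_sd_state n : measurable_fun setT (sd_state n : T -> RR).
Proof. exact: measurable_lincomb. Qed.

Lemma sd_state_equidistributed (k : nat) (F : RR * RR -> R) (I : R) :
  (0 < k)%N -> measurable_fun setT F -> (forall p, 0 <= F p <= 1)%R ->
  (forall x e, F (x + 1, e) = F (x, e))%R ->
  (forall x e, F (x, e + 1) = F (x, e))%R ->
  \int[mu]_(e in `[0%R, 1%R]) \int[mu]_(x in `[0%R, 1%R]) (F (x, e))%:E = I%:E ->
  \int[P]_w (F (sd_state n w, sd_state (n + k) w - sd_state n w)%R)%:E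
    @[n --> \oo] --> I%:E.
Proof.
move=> k0 mF F01 pF1 pF2 FI.
pose F' p := (1 - F p)%R.
have F0 p : (0 <= F p)%R by have /andP[] := F01 p.
have F'0 p : (0 <= F' p)%R by rewrite subr_ge0; have /andP[] := F01 p.
have mF' : measurable_fun setT F' by exact: measurable_funB.
have mpair n : measurable_fun setT
    (fun w => (sd_state n w, sd_state (n + k) w - sd_state n w)%R : RR * RR).
  apply: measurable_fun_pair; first exact: measurable_sd_state.
  by apply: measurable_funB; exact: measurable_sd_state.
have F'I : \int[mu]_(e in `[0%R, 1%R]) \int[mu]_(x in `[0%R, 1%R]) (F' (x, e))%:E =
    (1 - I)%:E.
  (* Read as an integral over a product of two probabilities, the double integral gives 1 total mass
     1, whence the value [1 - I] for [F']. *)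
  pose U := uniform_prob (@ltr01 R).
  have dbl (G : RR * RR -> R) : measurable_fun setT G -> (forall p, 0 <= G p)%R ->
      \int[mu]_(e in `[0%R, 1%R]) \int[mu]_(x in `[0%R, 1%R]) (G (x, e))%:E =
      \int[U \x U]_p (G p)%:E.
    move=> mG G0.
    have mGE : measurable_fun setT (EFin \o G) by exact/measurable_EFinP.
    rewrite integral_itv01E; last 2 first.
    - by apply: (measurable_integral_fst01 mGE) => p; rewrite lee_fin.
    - by move=> e; apply: integral_ge0 => x _; rewrite lee_fin.
    rewrite (fubini_tonelli2 (EFin \o G))//.
    apply: eq_integral => e _; apply: integral_itv01E.
      exact: (measurableT_comp mGE (pair2_measurable e)).
    by move=> x; rewrite lee_fin.
  move: FI; rewrite !dbl// => FI.
  have := @integral_onem_probability _ _ (U \x U)%E F mF F01.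
  rewrite FI -/F'; case: (\int[_]_p (F' p)%:E) => // r [<-].
  by rewrite addrAC subrr add0r.
pose E (G : RR * RR -> R) n :=
  \int[P]_w (G (sd_state n w, sd_state (n + k) w - sd_state n w)%R)%:E.
have EE' n : E F n + E F' n = 1.
  apply: (@integral_onem_probability _ _ P
    (fun w => F (sd_state n w, sd_state (n + k) w - sd_state n w)%R)) => //.
  exact: (measurableT_comp mF (mpair n)).
have E0 n : 0 <= E F n by apply: integral_ge0 => w _; rewrite lee_fin.
have E'0 n : 0 <= E F' n by apply: integral_ge0 => w _; rewrite lee_fin.
have Efin n : E F n = (fine (E F n))%:E.
  rewrite fineK//; have := EE' n; have := E0 n; have := E'0 n.
  by case: (E F n) => // ; case: (E F' n).
have E'fin n : E F' n = (1 - fine (E F n))%:E.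
  have := EE' n; rewrite Efin; case: (E F' n) => // r [<-].
  by rewrite /= addrAC subrr add0r.
have mFE : measurable_fun setT (EFin \o F) by exact/measurable_EFinP.
have mFE' : measurable_fun setT (EFin \o F') by exact/measurable_EFinP.
have ub n : (t < n)%N -> (fine (E F n) <= sd_rate k n * I)%R.
  move=> tn; rewrite -lee_fin -Efin EFinM -FI.
  apply: (@sd_state_expectation_le k n (EFin \o F)) => //.
  - by move=> e x /=; rewrite pF1.
  - by move=> x e /=; rewrite pF2.
(* The upper bound for the mean of [F' = 1 - F] is a lower bound for that of [F]. *)
have lb n : (t < n)%N -> (1 - sd_rate k n * (1 - I) <= fine (E F n))%R.
  move=> tn; rewrite lerBlDr -lerBlDl -lee_fin -E'fin EFinM -F'I.
  apply: (@sd_state_expectation_le k n (EFin \o F')) => //.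
  - by move=> e x /=; rewrite /F' pF1.
  - by move=> x e /=; rewrite /F' pF2.
suff: E F n @[n --> \oo] --> I%:E by [].
rewrite (funext Efin).
apply: cvg_EFin; first exact: nearW.
apply: (@squeeze_cvgr _ _ _ _ (fun n => 1 - sd_rate k n * (1 - I))%R (fun n => sd_rate k n * I)%R).
- by near=> n; rewrite lb ?ub//; near: n; exact: nbhs_infty_gt.
- have -> : I = (1 - 1 * (1 - I))%R by rewrite mul1r opprB addrCA subrr addr0.
  apply: cvgB; first exact: cvg_cst.
  have -> : (1 - (1 - 1 * (1 - I)) = 1 - I)%R by ring.
  by apply: cvgMl; exact: sd_rate_cvg1.
- rewrite -[X in _ --> X]mul1r; apply: cvgMl; exact: sd_rate_cvg1.
Unshelve. all: by end_near. Qed.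

End equidistribution.

(** * The quantization noise *)

Section sawtooth.
Context {R : realType}.
Notation RR := (measurableTypeR R).
Notation mu := (@lebesgue_measure R).

(* [frac] alone would be the constructor of fractions of MathComp. *)
Definition sawtooth (x : R) : R := 2^-1 - Defs.frac x.

Lemma measurable_sawtooth : measurable_fun setT (sawtooth : RR -> RR).
Proof. by apply: measurable_funB => //; exact: measurable_frac. Qed.

Lemma sawtooth_itv x : - 2^-1 <= sawtooth x <= 2^-1.
Proof.
rewrite /sawtooth /Defs.frac; have := floor_le x; have := floorD1_gt x.
by rewrite intrD; move: (Num.floor x)%:~R => k; lra.
Qed.

Lemma sawtoothD1 x : sawtooth (x + 1) = sawtooth x.
Proof.
rewrite /sawtooth /Defs.frac floorDrz ?rpred1// floor1 intrD.
by congr (_ - _); ring.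
Qed.

Lemma sawtooth_id x : 0 <= x < 1 -> sawtooth x = 2^-1 - x.
Proof.
move=> x01; rewrite /sawtooth /Defs.frac.
by have -> : Num.floor x = 0 by [apply: floor_def; rewrite add0r]; rewrite subr0.
Qed.

Local Open Scope ereal_scope.

(** On [[0, 1[] the sawtooth is [2^-1 - x], so this is an affine substitution; the jump at 1 is a
    null set. *)
Lemma integral_sawtooth (g : RR -> R) :
  measurable_fun setT g -> (forall y, - 2^-1 <= y <= 2^-1 -> 0 <= g y)%R ->
  \int[mu]_(x in `[0%R, 1%R]) (g (sawtooth x))%:E =
  \int[mu]_(y in `[(- 2^-1)%R, (2^-1)%R]) (g y)%:E.
Proof.
move=> mg g0.
have mgE : measurable_fun (setT : set RR) (fun y => (g y)%:E : \bar R).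
  exact/measurable_EFinP.
rewrite integral_itv_cc_co; last exact: (measurableT_comp mgE measurable_sawtooth).
transitivity (\int[mu]_(x in `[0%R, 1%R[) (g (2^-1 - x))%:E).
  by apply: eq_integral => x; rewrite inE/= in_itv/= => /sawtooth_id ->.
rewrite -integral_itv_cc_co; last first.
  apply: (measurableT_comp mgE); apply: measurable_funB => //.
rewrite integral_mkcond [RHS]integral_mkcond.
pose h := (fun y => (g y)%:E : \bar R) \_ (`[(- 2^-1)%R, (2^-1)%R] : set RR).
have aff := @ge0_integral_affine R (-1) 2^-1 h.
rewrite normrN1 invr1 mul1e in aff; rewrite -aff.
- apply: eq_integral => x _; rewrite /h !patchE mulN1r addrC.
  suff -> : (x \in (`[0%R, 1%R]%classic : set RR)) =
    ((- x + 2^-1)%R \in (`[(- 2^-1)%R, (2^-1)%R]%classic : set RR)) by [].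
  by apply/idP/idP; rewrite !inE/= !in_itv/=; lra.
- by rewrite oppr_eq0 oner_eq0.
- apply/(measurable_restrictT _ _).1; first exact: measurable_itv.
  exact: measurable_funTS.
- move=> x; apply: erestrict_ge0 => y; rewrite /= in_itv/= => yitv.
  by rewrite lee_fin g0.
Qed.

Lemma integral_cubic (p q r u v : R) : (u < v)%R ->
  \int[mu]_(y in `[u, v]) (p * y ^+ 2 + q * y + r)%:E =
  ((p * v ^+ 3 / 3 + q * v ^+ 2 / 2 + r * v) -
   (p * u ^+ 3 / 3 + q * u ^+ 2 / 2 + r * u))%:E.
Proof.
move=> uv.
pose G (y : R) : R := (p * y ^+ 3 / 3 + q * y ^+ 2 / 2 + r * y)%R.
have dG (y : R) : is_derive y (1%R : R) G (p * y ^+ 2 + q * y + r)%R.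
  rewrite /G; by apply: is_derive_eq; rewrite /GRing.scale/=; field.
have cG : continuous G.
  move=> y; apply/differentiable_continuous/derivable1_diffP.
  exact: ex_derive.
rewrite (@continuous_FTC2 R _ G u v uv)//.
- apply: continuous_subspaceT => y.
  apply: cvgD; last exact: cvg_cst.
  apply: cvgD; apply: cvgMr; last exact: cvg_id.
  exact: exprn_continuous.
- split.
  + by move=> y _; exact: ex_derive.
  + by apply/cvg_at_right_filter; exact: cG.
  + by apply/cvg_at_left_filter; exact: cG.
- by move=> y _; rewrite derive1E; exact: derive_val.
Qed.

End sawtooth.

(** * Limits of one- and two-time expectations of the sawtooth *)

Section sawtooth_limits.
Context {d : measure_display} {T : measurableType d} {R : realType}.
Notation RR := (measurableTypeR R).
Notation mu := (@lebesgue_measure R).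
Context (gamma : probability RR R)
  (gammaE : forall A, measurable A -> gamma A = normal_prob (0%R : R) 1%R A).
Context (P : probability T R) (W : nat -> {mfun T >-> R}) (t : nat).
Hypothesis Wfresh : fresh_after gamma P W t.
Context (a : R) (a_itv : - 2^-1 < a < 2^-1) (eta : nat -> R).
Hypothesis eta0 : eta 0%N = 1.
Hypothesis etaS : forall n, n.+1%:R * eta n.+1 = (n%:R + a) * eta n.
Context (Delta : R) (Delta_gt0 : 0 < Delta).

Let phi n (w : T) := sawtooth (sd_state W eta Delta n w).

Local Open Scope ereal_scope.

Lemma sawtooth_expectation_cvg (g : RR -> R) (I : R) :
  measurable_fun setT g -> (forall y, - 2^-1 <= y <= 2^-1 -> 0 <= g y <= 1)%R ->
  \int[mu]_(y in `[(- 2^-1)%R, (2^-1)%R]) (g y)%:E = I%:E ->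
  \int[P]_w (g (phi n w))%:E @[n --> \oo] --> I%:E.
Proof.
move=> mg g01 gI.
have ms : measurable_fun (setT : set (RR * RR)) (fun p : RR * RR => g (sawtooth p.1)).
  apply: (measurableT_comp mg).
  exact: (measurableT_comp measurable_sawtooth measurable_fst).
(* The joint statement at lag 1, for a function of the first coordinate only, gives the one-time
   limit. *)
apply: (sd_state_equidistributed gammaE Wfresh a_itv eta0 etaS Delta_gt0 (k := 1%N)
  (F := fun p => g (sawtooth p.1)) _ ms).
- by [].
- by move=> p; apply: g01; exact: sawtooth_itv.
- by move=> x e /=; rewrite sawtoothD1.
- by [].
rewrite /= integral_sawtooth//; last by move=> y /g01/andP[].
rewrite gI integral_cst//= lebesgue_measure_itv/= lte_fin ltr01.
by rewrite oppr0 adde0 mule1.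
Qed.

Lemma sawtooth_cdf_cvg (x : R) :
  P [set w | (phi n w <= x)%R] @[n --> \oo] -->
  uniform_prob (ltNhalf_half (R := R)) `]-oo, x]%classic.
Proof.
have mx : measurable (`]-oo, x]%classic : set RR) by exact: measurable_itv.
set Y := uniform_prob _ _.
have Yfin : Y \is a fin_num by exact: fin_num_measure.
have YE : \int[mu]_(y in `[(- 2^-1)%R, (2^-1)%R]) (\1_(`]-oo, x]%classic : set RR) y)%:E =
    (fine Y)%:E.
  rewrite fineK// /Y.
  have -> : uniform_prob (ltNhalf_half (R := R)) `]-oo, x]%classic =
     \int[uniform_prob (ltNhalf_half (R := R))]_y (\1_(`]-oo, x]%classic : set RR) y)%:E.
    by rewrite integral_indic// setIT.
  rewrite integral_uniform//.
  - have -> : (2^-1 - - 2^-1 = 1 :> R)%R by field.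
    by rewrite invr1 mul1e.
  - by apply/measurable_EFinP; exact: measurable_indic.
have := sawtooth_expectation_cvg (g := \1_(`]-oo, x]%classic : set RR)) _ _ YE.
rewrite fineK// => H.
have -> : (fun n => P [set w | (phi n w <= x)%R]) =
    (fun n => \int[P]_w (\1_(`]-oo, x]%classic : set RR) (phi n w))%:E).
  apply/funext => n.
  have -> : (fun w => (\1_(`]-oo, x]%classic : set RR) (phi n w))%:E) =
     (fun w => (\1_[set w | (phi n w <= x)%R] w)%:E : \bar R).
    by apply/funext => w; rewrite !indicE !mem_setE in_itv.
  rewrite integral_indic ?setIT//.
  rewrite (_ : [set w | _] = phi n @^-1` (`]-oo, x]%classic : set RR)); last first.
    by apply/seteqP; split => w /=; rewrite in_itv.
  rewrite -[X in measurable X]setTI.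
  exact: (measurableT_comp measurable_sawtooth (measurable_sd_state W eta Delta n)).
apply: H; first exact: measurable_indic.
by move=> y _; rewrite indicE ler0n lern1 leq_b1.
Qed.

Lemma sawtooth_square_cvg :
  \int[P]_w (phi n w * phi n w)%:E @[n --> \oo] --> (12^-1 : R)%:E.
Proof.
apply: (@sawtooth_expectation_cvg (fun y => y * y)%R).
- exact: measurable_funM.
- by move=> y yitv; apply/andP; split; nra.
- transitivity (\int[mu]_(y in `[(- 2^-1)%R, (2^-1)%R]) (1 * y ^+ 2 + 0 * y + 0)%:E).
    by apply: eq_integral => y _; congr EFin; ring.
  by rewrite integral_cubic ?ltNhalf_half//; congr EFin; field.
Qed.

Lemma sawtooth_product_cvg (k : nat) : (0 < k)%N ->
  \int[P]_w (phi n w * phi (n + k) w)%:E @[n --> \oo] --> (0 : \bar R).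
Proof.
move=> k0.
(* The product lies in [[-1/4, 1/4]]; adding [2^-1] brings it into [[0, 1]], and the constant is
   subtracted again in [split]. *)
pose F (p : RR * RR) : R := (sawtooth p.1 * sawtooth (p.1 + p.2) + 2^-1)%R.
have mF : measurable_fun (setT : set (RR * RR)) F.
  apply: measurable_funD; last exact: measurable_cst.
  apply: measurable_funM; first exact: (measurableT_comp measurable_sawtooth measurable_fst).
  apply: (measurableT_comp measurable_sawtooth).
  exact: (measurable_funD measurable_fst measurable_snd).
have F01 p : (0 <= F p <= 1)%R.
  rewrite /F; have := sawtooth_itv p.1; have := sawtooth_itv (p.1 + p.2).
  move: (sawtooth p.1) (sawtooth _) => u v vitv uitv.
  by apply/andP; split; nra.
have FE : \int[mu]_(e in `[0%R, 1%R]) \int[mu]_(x in `[0%R, 1%R]) (F (x, e))%:E = (2^-1 : R)%:E.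
  have mFE : measurable_fun setT (EFin \o F) by exact/measurable_EFinP.
  have F0 p : 0 <= (EFin \o F) p by rewrite lee_fin; have /andP[] := F01 p.
  rewrite integral_itv01E; last 2 first.
  - exact: (measurable_integral_fst01 mFE F0).
  - by move=> e; apply: integral_ge0 => x _; exact: F0.
  under eq_integral.
    move=> e _; rewrite integral_itv01E; last 2 first.
    - exact: (measurableT_comp mFE (pair2_measurable e)).
    - by move=> x; exact: F0.
    over.
  (* The order is exchanged to integrate over [e] first: for fixed [x], [sawtooth (x + e)] runs
     through a full period and has mean 0, so only [2^-1] remains. *)
  rewrite -(fubini_tonelli (EFin \o F) mFE F0).
  rewrite -[RHS](integral_probability_cst (uniform_prob (@ltr01 R))).
  apply: eq_integral => x _.
  rewrite -integral_itv01E; last 2 first.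
  - exact: (measurableT_comp mFE (pair1_measurable x)).
  - by move=> e; exact: F0.
  pose h (e : RR) : R := (sawtooth x * e + 2^-1)%R.
  have mh : measurable_fun (setT : set RR) h.
    by apply: measurable_funD => //; exact: measurable_funM.
  have h0 y : (- 2^-1 <= y <= 2^-1 -> 0 <= h y)%R.
    by move=> yitv; rewrite /h; have := sawtooth_itv x; move: (sawtooth x) => u uitv; nra.
  have mhs : measurable_fun (setT : set RR) (fun e => (h (sawtooth e))%:E : \bar R).
    by apply/measurable_EFinP; exact: (measurableT_comp mh measurable_sawtooth).
  have hs0 e : 0 <= (h (sawtooth e))%:E by rewrite lee_fin h0// sawtooth_itv.
  transitivity (\int[mu]_(e in `[0%R, 1%R]) (h (sawtooth (e + x)))%:E).
    apply: eq_integral => e _; congr EFin; rewrite /F /h/=.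
    by congr (_ * sawtooth _ + _)%R; exact: addrC.
  rewrite (ge0_integral_itv_translate (f := fun e => (h (sawtooth e))%:E) _ _ _ _ _ mhs hs0).
  rewrite add0r addrC integral_periodic1//; last by move=> e; rewrite sawtoothD1.
  rewrite (integral_sawtooth mh h0).
  transitivity (\int[mu]_(y in `[(- 2^-1)%R, (2^-1)%R]) (0 * y ^+ 2 + sawtooth x * y + 2^-1)%:E).
    by apply: eq_integral => y _; congr EFin; rewrite /h mul0r add0r.
  by rewrite integral_cubic ?ltNhalf_half//; congr EFin; field.
have := sd_state_equidistributed gammaE Wfresh a_itv eta0 etaS Delta_gt0 k0 mF F01 _ _ FE.
move=> H.
have mphi n : measurable_fun setT (phi n : T -> RR).
  exact: (measurableT_comp measurable_sawtooth (measurable_sd_state W eta Delta n)).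
have mpp n : measurable_fun setT (fun w => phi n w * phi (n + k) w)%R.
  by apply: measurable_funM; exact: mphi.
have split n : \int[P]_w (F (sd_state W eta Delta n w,
      sd_state W eta Delta (n + k) w - sd_state W eta Delta n w)%R)%:E -
      (2^-1 : R)%:E =
    \int[P]_w (phi n w * phi (n + k) w)%:E.
  have ppint : P.-integrable setT (EFin \o (fun w => phi n w * phi (n + k) w)%R).
    apply: (@le_integrable _ _ _ P _ measurableT _ (EFin \o cst (1 : R)%R)).
    - exact/measurable_EFinP.
    - move=> w _ /=; rewrite lee_fin normr1 normrM mulr_ile1 ?normr_ge0//.
        rewrite ler_norml; have := sawtooth_itv (sd_state W eta Delta n w).
        by rewrite -/(phi n w); lra.
      rewrite ler_norml; have := sawtooth_itv (sd_state W eta Delta (n + k) w).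
      by rewrite -/(phi (n + k)%N w); lra.
    - exact: finite_measure_integrable_cst.
  transitivity (\int[P]_w ((phi n w * phi (n + k) w)%:E + (2^-1 : R)%:E) - (2^-1 : R)%:E).
    congr (_ - _); apply: eq_integral => w _; rewrite /F/= EFinD.
    by congr ((_ * sawtooth _)%:E + _); rewrite addrC subrK.
  rewrite integralD//=; last exact: finite_measure_integrable_cst.
  by rewrite integral_probability_cst addeK.
under eq_fun do rewrite -split.
have -> : (0 : \bar R) = (2^-1 : R)%:E - (2^-1 : R)%:E by rewrite subee.
apply: cvgeB => //; last exact: cvg_cst.
apply: H.
- by move=> x e; rewrite /F/= addrAC !sawtoothD1.
- by move=> x e; rewrite /F/= addrA sawtoothD1.
Qed.

End sawtooth_limits.

(** * Fractional Brownian motion, its quantization noise and conditioning on boundedness *)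

Section noise_of_fbm.
Context {d : measure_display} {T : measurableType d} {R : realType}.
Implicit Types (W : nat -> {mfun T >-> R}) (H b : R).

(** For [H = 1/2] the kernel is the unit impulse, so that one recurrence with [a = H - 1/2] covers
    both cases. *)
Definition fgn_coef H (n : nat) : R :=
  if H == 2^-1 then (n == 0%N)%:R else hcoef (H - 2^-1) n.

Lemma fgn_coef0 H : 0 < H < 1 -> fgn_coef H 0 = 1.
Proof.
move=> /andP[H0 H1]; rewrite /fgn_coef; case: eqP => [//|/eqP H2].
apply: hcoef0; first by lra.
by rewrite subr_eq0.
Qed.

Lemma fgn_coefS H n : 0 < H < 1 ->
  n.+1%:R * fgn_coef H n.+1 = (n%:R + (H - 2^-1)) * fgn_coef H n.
Proof.
move=> /andP[H0 H1]; rewrite /fgn_coef; case: eqP => [->|/eqP H2].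
  by rewrite subrr addr0 mulr0; case: n => [|n]; rewrite ?mul0r ?mulr0.
apply: hcoefS; first by lra.
by rewrite subr_eq0.
Qed.

Lemma fgn_sumE H W n w :
  fgn H W n w = \sum_(0 <= j < n.+1) fgn_coef H (n - j) * W j w.
Proof.
rewrite /fgn/= /fgn_fun /fgn_coef; case: eqP => _ //.
rewrite big_nat_recr//= subnn eqxx mul1r big_nat_cond big1 ?add0r//.
move=> i /andP[/andP[_ iN] _].
by rewrite subn_eq0 leqNgt iN mul0r.
Qed.

Lemma fbm_sumE H W n w :
  fbm H W n w = \sum_(0 <= j < n.+1) psum (fgn_coef H) (n - j)%N * W j w.
Proof.
rewrite -sum_convolution_psum /fbm/= /fbm_fun.
by apply: eq_bigr => i _; exact: fgn_sumE.
Qed.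

Lemma quantization_noiseE b M H W n w :
  quantization_noise b M (fbm H W) n w =
  sawtooth (sd_state W (fgn_coef H) (quantizer_step b M) n w).
Proof.
rewrite /quantization_noise/= /quantization_noise_fun /sawtooth; congr (_ - Defs.frac _).
rewrite big_split/= addrC /sd_state /lincomb; congr (_ + _).
  by rewrite big_const_nat subn0 iter_addr_0 -[_ *+ _]mulr_natl.
rewrite -mulr_suml.
under eq_bigr do rewrite fbm_sumE.
rewrite sum_convolution_psum mulr_suml; apply: eq_big_nat => j /andP[_ jn].
by rewrite /sd_coef -ltnS jn mulrAC.
Qed.

Lemma measurable_fbm_other H W n j : (n < j)%N ->
  measurable_fun setT (fbm H W n : other_noise W j -> measurableTypeR R).
Proof.
move=> nj.
pose u i := if (i <= n)%N then psum (fgn_coef H) (n - i)%N else 0.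
have -> : (fbm H W n : T -> R) = lincomb W n.+1 u 0.
  apply/funext => w; rewrite fbm_sumE /lincomb add0r.
  by apply: eq_big_nat => i /andP[_ iN]; rewrite /u -ltnS iN.
by apply: measurable_lincomb_other; rewrite /u leqNgt nj.
Qed.

(** The event constrains the motion up to time [t], hence involves only the noises
    [W 0, ..., W t]. *)
Lemma measurable_bounded_on_horizon_other H W b t j : (t < j)%N ->
  measurable (bounded_on_horizon (fbm H W) b t : set (other_noise W j)).
Proof.
move=> tj.
have -> : bounded_on_horizon (fbm H W) b t =
    \bigcap_n (if (n <= t)%N then fbm H W n @^-1` `[- b, b]%classic else setT).
  apply/seteqP; split => w /= Sw n => [_|nt]; first by case: ifP => // /Sw.
  by have := Sw n I; rewrite nt.
apply: bigcap_measurable => // n _; case: ifP => // nt.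
rewrite -[X in measurable X]setTI.
have mf := @measurable_fbm_other H W n j (leq_ltn_trans nt tj).
exact: (mf measurableT _ (measurable_itv `[- b, b])).
Qed.

Local Open Scope ereal_scope.

(** Positivity of [P A] excludes the default branch of [mnormalize]. *)
Lemma cond_probabilityE (P : probability T R) (A : set T) (mA : measurable A) (B : set T) :
  0 < P A -> cond_probability P mA B = P (B `&` A) * (fine (P A))^-1%:E.
Proof.
move=> PA; have PT : P (setT `&` A) = P A by rewrite setTI.
rewrite /cond_probability/= /mnormalize; case: ifPn => h.
  exfalso; move: h.
  change (is_true ((P (setT `&` A) == 0) || (P (setT `&` A) == +oo)) -> False).
  by rewrite PT gt_eqF//= lt_eqF// (le_lt_trans (probability_le1 P mA)) ?ltry.
change (P (B `&` A) * (fine (P (setT `&` A)))^-1%:E =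
  P (B `&` A) * (fine (P A))^-1%:E).
by rewrite PT.
Qed.

(** Intersecting [B] with the event keeps it measurable for the noises other than [W j], and the
    normalizing constant is a common factor. *)
Lemma cond_probability_fresh (gamma : probability (measurableTypeR R) R)
    (P : probability T R) H W b t :
  fresh_after gamma P W t -> 0 < P (bounded_on_horizon (fbm H W) b t) ->
  fresh_after gamma
    (cond_probability P (measurable_bounded_on_horizon (fbm H W) b t)) W t.
Proof.
move=> PW PA j tj B C mB mC; rewrite !cond_probabilityE//.
rewrite setIAC (PW j tj)//; last first.
  apply: measurableI => //; exact: measurable_bounded_on_horizon_other.
by rewrite muleAC.
Qed.

End noise_of_fbm.

(** * Limit means and limit correlations *)

Section limit_means.
Context {d : measure_display} {T : measurableType d} {R : realType}.
Local Open Scope ereal_scope.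

Lemma cesaro_ereal (u : nat -> \bar R) (l : R) :
  (forall n, u n \is a fin_num) -> u n @[n --> \oo] --> l%:E ->
  (N%:R^-1)%:E * (\sum_(1 <= n < N.+1) u n) @[N --> \oo] --> l%:E.
Proof.
move=> ufin ul.
(* The limit mean sums from index 1, whereas [arithmetic_mean] starts at 0 and divides by [N + 1];
   both indices are shifted by one. *)
pose r n := fine (u n.+1).
have rl : r n @[n --> \oo] --> l.
  have fl : fine \o u @ \oo --> l by exact: fine_cvg.
  by have := cvg_shiftS (fine \o u) (nbhs l); rewrite propeqE => -[_]; apply.
have := cesaro rl => ml.
suff : (fun N => (N.+1%:R^-1)%:E * (\sum_(1 <= n < N.+2) u n)) @ \oo --> l%:E.
  move=> h; have := cvg_shiftS (fun N => (N%:R^-1)%:E * (\sum_(1 <= n < N.+1) u n)) (nbhs l%:E).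
  by rewrite propeqE => -[+ _]; apply.
have -> : (fun N => (N.+1%:R^-1)%:E * (\sum_(1 <= n < N.+2) u n)) =
    EFin \o arithmetic_mean r.
  apply/funext => N; rewrite /= /arithmetic_mean/= /series/= EFinM; congr (_ * _).
  rewrite big_add1/= -sumEFin; apply: eq_bigr => i _.
  by rewrite /r fineK.
by apply: cvg_EFin; [exact: nearW|exact: ml].
Qed.

Lemma integral_bounded_fin_num (P : probability T R) (g : T -> R) :
  measurable_fun setT g -> (forall w, `|g w| <= 1)%R ->
  \int[P]_w (g w)%:E \is a fin_num.
Proof.
move=> mg g1; apply: integrable_fin_num => //.
apply: (@le_integrable _ _ _ P _ measurableT _ (EFin \o cst (1 : R)%R)).
- exact/measurable_EFinP.
- by move=> w _ /=; rewrite lee_fin normr1.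
- exact: finite_measure_integrable_cst.
Qed.

Lemma white_of_limits (P : probability T R) (e : nat -> {mfun T >-> R}) :
  (forall n w, `|e n w| <= 1)%R ->
  \int[P]_w (e n w * e n w)%:E @[n --> \oo] --> (12^-1 : R)%:E ->
  (forall k, (0 < k)%N ->
    \int[P]_w (e n w * e (n + k)%N w)%:E @[n --> \oo] --> (0 : \bar R)) ->
  asymptotically_white P e.
Proof.
move=> e1 sq prod k.
have mext z : measurable_fun setT (extend_by0 (fun n => e n : T -> R) z).
  by case: z => n /=; [exact: measurable_funP|exact: measurable_cst].
have ext1 z w : (`|extend_by0 (fun n => e n : T -> R) z w| <= 1)%R.
  by case: z => n /=; rewrite ?normr0.
rewrite /has_limit_correlation /has_limit_mean.
pose u n := \int[P]_w (e n w * extend_by0 (fun n => e n : T -> R) (n%:Z + k)%R w)%:E.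
have ufin n : u n \is a fin_num.
  apply: integral_bounded_fin_num; first exact: measurable_funM.
  by move=> w; rewrite normrM mulr_ile1.
have uE n : 'E_P[fun w => (e n w * extend_by0 (fun n => e n : T -> R) (n%:Z + k) w)%R] = u n.
  by rewrite unlock.
under eq_fun do under eq_bigr do rewrite uE.
have -> : (if (k == 0 :> int)%R then 12^-1%:E else 0) =
    (if (k == 0 :> int)%R then 12^-1 else 0 : R)%R%:E.
  by case: ifP.
apply: cesaro_ereal => //.
case: k @u ufin uE => [[|k]|k] u _ _ /=.
- move: sq; rewrite (_ : (fun n => _) = u)//.
  by apply/funext => n; rewrite /u addr0.
- move: (prod k.+1 isT); rewrite (_ : (fun n => _) = u)//.
(* For a negative lag the product at [n] is the one with positive lag [k.+1] at time [n - k.+1], as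
   soon as [n >= k.+1]. *)
- have := prod k.+1 isT => h.
  have {}h : \int[P]_w (e (n - k.+1)%N w * e (n - k.+1 + k.+1)%N w)%:E
      @[n --> \oo] --> (0 : \bar R).
    exact: (cvg_comp _ _ (cvg_subnr k.+1) h).
  apply: cvg_trans h; apply: near_eq_cvg; near=> n.
  have kn : (k.+1 <= n)%N by near: n; exact: nbhs_infty_ge.
  rewrite subnK// /u; apply: eq_integral => w _.
  by rewrite NegzE subzn//= mulrC.
Unshelve. all: by end_near. Qed.

End limit_means.

(** * Uniformity and whiteness under any law with fresh noise *)

Section conclusion.
Context {d : measure_display} {T : measurableType d} {R : realType}.

(** Stated for an arbitrary law with fresh noise after [t], so as to apply both to the original
    probability and to the conditional one. *)
Lemma fresh_asymptotics (gamma : probability (measurableTypeR R) R)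
    (gammaE : forall A, measurable A -> gamma A = normal_prob (0%R : R) 1%R A)
    (P : probability T R) (W : nat -> {mfun T >-> R}) (t : nat) (H b : R) (M : nat) :
  fresh_after gamma P W t -> 0 < H < 1 -> 0 < b -> (1 < M)%N ->
  let e := quantization_noise b M (fbm H W) in
  asymptotically_uniform P e /\ asymptotically_white P e.
Proof.
move=> PW H01 b0 M1 e.
have a_itv : - 2^-1 < H - 2^-1 < 2^-1 by move: H01 => /andP[h0 h1]; lra.
have D0 : 0 < quantizer_step b M.
  by rewrite /quantizer_step divr_gt0 ?mulr_gt0// subr_gt0 ltr1n.
have eE n w : e n w = sawtooth (sd_state W (fgn_coef H) (quantizer_step b M) n w).
  exact: quantization_noiseE.
have eta0 := fgn_coef0 H01.
have etaS n := fgn_coefS n H01.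
split.
  move=> x _.
  have := sawtooth_cdf_cvg gammaE PW a_itv eta0 etaS D0 (x := x).
  apply: cvg_trans; apply: near_eq_cvg; apply: nearW => n.
  rewrite /cdf /distribution /pushforward; congr (P _).
  by apply/seteqP; split => w /=; rewrite in_itv/= eE.
apply: white_of_limits.
- move=> n w; rewrite eE ler_norml.
  by have := sawtooth_itv (sd_state W (fgn_coef H) (quantizer_step b M) n w); lra.
- have := sawtooth_square_cvg gammaE PW a_itv eta0 etaS D0.
  apply: cvg_trans; apply: near_eq_cvg; apply: nearW => n.
  by apply: eq_integral => w _; rewrite eE.
- move=> k k0; have := sawtooth_product_cvg gammaE PW a_itv eta0 etaS D0 k0.
  apply: cvg_trans; apply: near_eq_cvg; apply: nearW => n.
  by apply: eq_integral => w _; rewrite !eE.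
Qed.

End conclusion.

Unset Implicit Arguments.
Set Strict Implicit.
Set Printing Implicit Defensive.

Theorem theorem2 (R : realType) (d : measure_display) (T : measurableType d)
    (P : probability T R) (H : R) (H_itv : 0 < H < 1)
    (W : nat -> {RV P >-> R}) (W_white : standard_gaussian_white_noise P W)
    (b : R) (b_gt0 : 0 < b) (M : nat) (M_gt1 : (1 < M)%N) (t : nat)
    (bounded_t : (0 < P (bounded_on_horizon (fbm H W) b t))%E) :
  let e := quantization_noise b M (fbm H W) in
  let P_t := cond_probability P (measurable_bounded_on_horizon (fbm H W) b t) in
  (asymptotically_uniform P e /\ asymptotically_white P e) /\
  (asymptotically_uniform P_t e /\ asymptotically_white P_t e).
Proof.
move=> e P_t; have [law indep] := W_white.
have Pfresh : fresh_after (normal_prob (0%R : R) 1%R) P W t.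
  by apply: independent_fresh => // n A mA; exact: law.
split; first exact: (fresh_asymptotics (fun _ _ => erefl) Pfresh).
apply: (fresh_asymptotics (fun _ _ => erefl) _ H_itv b_gt0 M_gt1 (t := t)).
exact: cond_probability_fresh.
Qed.
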